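(* Let $n\in\mathbb{N}$. The following conditions are equivalent: (a) the number $b(2n)$ is not a sum of three squares; (b) $n = 2^{2k+1}(4s+1)$ for some $k,s \in \mathbb{N}$ such that $t_s = -1$; (c) $n=2^{2k+1}(8r+2t_{r}+3)$ for some $k,r \in \mathbb{N}$; (d) $\chi(n) = 1$, where $\chi:\mathbb{N}\to\{0,1\}$ is defined by $\chi(0) = 0$ and, for all $n\in\mathbb{N}$, $$\chi(2n+1)=0, \quad \chi(4n)=\chi(n), \quad \chi(8n+2)=T_n, \quad \chi(8n+6)=0.$$
   Context: $\mathbb{N}$ is the set of non-negative integers. The binary partition function $b(n)$ is the number of partitions of $n$ into parts that are powers of two, i.e. $\sum_{n\ge 0} b(n)x^n=\prod_{j\ge 0}\frac{1}{1-x^{2^j}}$. An integer $N$ is a sum of three squares if $N=x^2+y^2+z^2$ for some $x,y,z\in\mathbb{Z}$ (zero allowed). Let $s_2(n)$ be the number of digits $1$ in the binary expansion of $n$. The Prouhet-Thue-Morse sequence is $t_n=(-1)^{s_2(n)}$, and $T_n=s_2(n) \bmod 2\in\{0,1\}$, so that $t_n=1-2T_n$. *)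

(* Defs.v *)
From mathcomp Require Import all_boot all_order all_algebra.
Set Implicit Arguments.
Unset Strict Implicit.
Unset Printing Implicit Defensive.
Import Order.TTheory GRing.Theory Num.Theory.

(* A partition of n into powers of two is given by its multiplicities:
   m j is the number of parts equal to 2 ^ j. Both j and m j are at most n,
   since j < 2 ^ j <= n whenever m j > 0, and m j <= m j * 2 ^ j <= n. *)
Definition binary_partitions (n : nat) : {set {ffun 'I_n.+1 -> 'I_n.+1}} :=
  [set m : {ffun 'I_n.+1 -> 'I_n.+1} | \sum_(j < n.+1) m j * 2 ^ j == n].

Definition b (n : nat) : nat := #|binary_partitions n|.

Definition sum_of_three_squares (N : int) : Prop :=
  exists x y z : int, (N = x ^+ 2 + y ^+ 2 + z ^+ 2)%R.

(* The digits of index i >= n vanish, because n < 2 ^ n. *)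
Definition s2 (n : nat) : nat := \sum_(i < n) (n %/ 2 ^ i) %% 2.

Definition t (n : nat) : int := ((-1) ^+ s2 n)%R.

Definition T (n : nat) : nat := s2 n %% 2.

(* The first argument is fuel; n itself is enough since n %/ 4 < n for n > 0.
   The defining equations of chi are the fields of chi_equations below. *)
Fixpoint chi_rec (fuel n : nat) : nat :=
  if fuel is f.+1 then
    if n %% 4 == 0 then chi_rec f (n %/ 4)
    else if n %% 8 == 2 then T (n %/ 8)
    else 0
  else 0.

Definition chi (n : nat) : nat := chi_rec n n.

Record chi_equations (f : nat -> nat) : Prop := ChiEquations {
  chi_eq_zero : f 0 = 0;
  chi_eq_odd : forall n, f (2 * n + 1) = 0;
  chi_eq_4n : forall n, f (4 * n) = f n;
  chi_eq_8n2 : forall n, f (8 * n + 2) = T n;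
  chi_eq_8n6 : forall n, f (8 * n + 6) = 0
}.

Lemma chi_rec_fuel f g n : n <= f -> n <= g -> chi_rec f n = chi_rec g n.
Proof.
elim: f g n => [|f IH] [|g] n //=.
- rewrite leqn0 => /eqP-> _; rewrite div0n mod0n /=.
  by elim: g => //= g <-.
- move=> _; rewrite leqn0 => /eqP->; rewrite div0n mod0n /=.
  by elim: {IH} f => //= f ->.
move=> nf ng; case: ifP => // _; case: n nf ng => [|n] nf ng.
  by rewrite div0n; apply: IH.
have lt : n.+1 %/ 4 < n.+1 by apply: ltn_Pdiv.
by apply: IH; rewrite -ltnS; apply: (leq_trans lt).
Qed.

Lemma chiE n :
  chi n = if n %% 4 == 0 then chi (n %/ 4)
          else if n %% 8 == 2 then T (n %/ 8) else 0.
Proof.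
case: n => // n; rewrite {1}/chi /=; case: ifP => // _.
apply: chi_rec_fuel => //.
by rewrite -ltnS; apply: ltn_Pdiv.
Qed.

Lemma chi_satisfies : chi_equations chi.
Proof.
have mod84 m : m %% 4 = (m %% 8) %% 4 by rewrite modn_dvdm.
split=> [|n|n|n|n] //.
- rewrite chiE; have: odd (2 * n + 1) by rewrite oddD oddM.
  move: (2 * n + 1) => m om; case: eqP => [h|_].
    by move: om; rewrite (divn_eq m 4) h addn0 oddM andbF.
  by case: eqP => // h; move: om; rewrite (divn_eq m 8) h oddD oddM andbF.
- by rewrite chiE mulnC modnMl mulnK.
- by rewrite chiE mod84 mulnC modnMDl divnMDl // addn0.
by rewrite chiE mod84 mulnC modnMDl.
Qed.

Lemma chi_unique f : chi_equations f -> f =1 chi.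
Proof.
case=> f0 fo f4 f2 f6; case: chi_satisfies => c0 co c4 c2 c6.
elim/ltn_ind=> n IH; case: (posnP n) => [->|n0]; first by rewrite f0 c0.
have d8 := divn_eq n 8; have := ltn_pmod n (isT : 0 < 8).
have [m4|m4] := eqVneq (n %% 4) 0.
  have e4 : n = 4 * (n %/ 4) by rewrite {1}(divn_eq n 4) m4 addn0 mulnC.
  by rewrite e4 f4 c4 IH // ltn_Pdiv.
have [on|en] := boolP (odd n).
  have e : n = 2 * n./2 + 1 by rewrite -{1}(odd_double_half n) on addnC mul2n.
  by rewrite e fo co.
move=> lt; have r4 : (n %% 8) %% 4 != 0 by rewrite modn_dvdm.
have r2 : ~~ odd (n %% 8).
  by move: en; rewrite {1}d8 oddD oddM andbF.
move: d8 lt r4 r2; move: (n %% 8) => r ->; rewrite mulnC.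
case: r => [|[|[|[|[|[|[|[|r]]]]]]]] //= _ _ _; first by rewrite f2 c2.
by rewrite f6 c6.
Qed.

Lemma chi_le1 n : chi n <= 1.
Proof.
elim/ltn_ind: n => -[|n] IH //; rewrite chiE; case: ifP => _.
  by apply: IH; apply: ltn_Pdiv.
by case: ifP => // _; rewrite /T -ltnS ltn_pmod.
Qed.

(* Main.v *)
Require Import Defs.
From mathcomp Require Import all_boot all_order all_algebra.
From mathcomp Require Import all_fingroup cyclic finfield.
From mathcomp Require Import realalg zify ring lra.
Set Implicit Arguments.
Unset Strict Implicit.
Unset Printing Implicit Defensive.
Import Order.TTheory GRing.Theory Num.Theory UnityRootTheory.

(** The sequence b(2n) is governed by its iterated partial sums, which are
    themselves expressed by the Thue-Morse sequence: modulo 32 one finds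
    b(16r + 4) = 4 t_r, b(16r + 12) = 4 t_r + 16 and b(8m) = b(2m) for even m,
    while b(2n) = 2 mod 4 when 2 has even exponent in n > 0.  Hence b(2n) is of
    the form 4^a (8k + 7) exactly when b(2n) = 28 mod 32, that is, when
    chi(n) = 1.

    The three-square theorem is then needed for N = 1, 2 mod 4 and N = 3 mod 8.
    If m > 0 is coprime to N, -m is a square mod N and -N is a square mod m, then
    N is a corner entry of a positive ternary Gram matrix of determinant 1, and
    such a form is equivalent to a sum of three squares.  To find m without
    Dirichlet's theorem on primes, let chi be the Jacobi symbol (-N/.), modulo
    4N, and let H be the subgroup of residues generated by the squares and by the
    primes q with chi(q) = 1.  Some r with chi(r) = 1 is such that an m built from
    primes of H and congruent to r up to squares fits, so it suffices that r be
    in H.  Otherwise a quadratic character psi is trivial on H with psi(r) = -1,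
    and comparing prime factorizations gives psi (1 * chi) = 1 * chi on integers
    coprime to 4N.  The left side is psi * (psi chi), a convolution of two
    non-principal characters, so by the hyperbola method its sums weighted by
    1/sqrt(n) are bounded; the right side is nonnegative, and at least 1 at
    squares, so its weighted sums dominate a harmonic series. *)

(** * The binary partition function modulo 32 *)

Local Open Scope ring_scope.

(** The generating product truncated to parts below [2 ^ K] with multiplicities below [L];
    coefficients of index less than both bounds are unaffected. *)
Definition part_gf (K L : nat) : {poly int} :=
  \prod_(j < K) \sum_(i < L) 'X^(i * 2 ^ j).

Lemma b_coef n : (b n)%:Z = (part_gf n.+1 n.+1)`_n.
Proof.
rewrite /part_gf bigA_distr_bigA /= coef_sum /b cardsE -sum1_card -[LHS]natz natr_sum /=.
rewrite big_mkcond; apply: eq_bigr => m _.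
have -> : \prod_(j < n.+1) ('X^(m j * 2 ^ j) : {poly int}) =
          'X^(\sum_(j < n.+1) m j * 2 ^ j)%N.
  by rewrite (big_morph (fun e => 'X^e : {poly int}) (@exprD _ _) (expr0 _)).
by rewrite coefXn unfold_in -[eqn _ _]/(_ == _) eq_sym; case: eqP.
Qed.

(** The factor [j = 0] is a truncated geometric series; the other parts are even, and halving them
    yields the product with one factor fewer. *)
Lemma part_gfS K L :
  (1 - 'X) * part_gf K.+1 L = (1 - 'X^L) * (part_gf K L \Po 'X^2).
Proof.
rewrite /part_gf big_ord_recl /= mulrA; congr (_ * _).
  under eq_bigr do rewrite expn0 muln1.
  by rewrite -[in RHS](expr1n _ L) subrXX; congr (_ * _);
     apply: eq_bigr => i _; rewrite expr1n mul1r.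
rewrite rmorph_prod /=; apply: eq_bigr => j _.
rewrite rmorph_sum /=; apply: eq_bigr => i _.
by rewrite comp_Xn_poly -exprM /bump /= add1n expnS mulnCA.
Qed.

Lemma part_gf_coefS K L n : (n.+1 < L)%N ->
  (part_gf K.+1 L)`_n.+1 =
  (part_gf K.+1 L)`_n + (if odd n then (part_gf K L)`_(n.+1)./2 else 0).
Proof.
move=> nL; have := congr1 (fun p : {poly int} => p`_n.+1) (part_gfS K L).
rewrite !mulrBl !mul1r !coefB coefXM coefXnM nL /= subr0 => /eqP.
rewrite subr_eq => /eqP->; rewrite addrC; congr (_ + _).
rewrite coef_comp_poly_Xn // dvdn2 /= divn2.
by case: (odd n).
Qed.

Lemma part_gf_coef0 K L : (0 < L)%N -> (part_gf K L)`_0 = 1.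
Proof.
move=> L0; rewrite -horner_coef0 /part_gf horner_prod big1 // => j _.
rewrite horner_sum (bigD1 (Ordinal L0)) //= mul0n expr0 hornerC big1 ?addr0 //.
by move=> i i0; rewrite hornerXn expr0n muln_eq0 expn_eq0 orbF -[_ == _]/(i == Ordinal L0)
  (negbTE i0).
Qed.

(** Both coefficients obey the recurrence of [part_gf_coefS]; where it drops a factor it also halves
    the index, so [n < 2 ^ K] persists. *)
Lemma part_gf_stable n K K' L L' : (n < L)%N -> (n < L')%N ->
  (n < 2 ^ K)%N -> (n < 2 ^ K')%N -> (part_gf K L)`_n = (part_gf K' L')`_n.
Proof.
elim/ltn_ind: n K K' L L' => -[_|n IH] K K' L L' nL nL' nK nK'.
  by rewrite !part_gf_coef0.
case: K nK => [|K] // nK; case: K' nK' => [|K'] // nK'.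
rewrite !part_gf_coefS // (IH n _ K.+1 K'.+1 L L') //; try lia.
congr (_ + _); case: ifP => // on; apply: IH; try lia.
all: by move: nK nK'; rewrite !expnS; lia.
Qed.

Lemma b0 : b 0 = 1%N.
Proof. by apply/eqP; rewrite -eqz_nat b_coef part_gf_coef0. Qed.

Lemma bS n : b n.+1 = (b n + if odd n then b (n.+1)./2 else 0)%N.
Proof.
apply/eqP; rewrite -eqz_nat PoszD.
have -> : (if odd n then b (n.+1)./2 else 0%N)%:Z =
          if odd n then (b (n.+1)./2)%:Z else 0 by case: ifP.
have lt2 k : (k < 2 ^ k)%N by apply: ltn_expl.
rewrite !b_coef part_gf_coefS //.
rewrite (@part_gf_stable n n.+2 n.+1 n.+2 n.+1) //; last first.
- exact: ltn_trans (lt2 _).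
- by rewrite (ltn_trans (lt2 n)) // ltn_exp2l.
apply/eqP; congr (_ + _); case: ifP => // on.
set k := (n.+1)./2.
have [h1 h2] : (k < n.+2)%N /\ (k < n.+1)%N by rewrite /k; lia.
apply: part_gf_stable => //.
  by apply: (leq_ltn_trans _ (lt2 _)).
by apply: ltn_trans (lt2 _).
Qed.

Local Close Scope ring_scope.

(** * The subsequence b(2n) and its iterated partial sums *)

Definition beven n := b (2 * n).
Definition beven_sum n := \sum_(k < n.+1) beven k.
Definition beven_sum2 n := \sum_(k < n.+1) beven_sum k.

Lemma beven0 : beven 0 = 1.  Proof. exact: b0. Qed.

Lemma b_odd n : b (2 * n).+1 = b (2 * n).
Proof. by rewrite bS oddM addn0. Qed.

Lemma bE n : b n = beven n./2.
Proof.
rewrite /beven mul2n -[in LHS](odd_double_half n); case: (odd n) => //.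
by rewrite -mul2n b_odd mul2n.
Qed.

Lemma bevenS n : beven n.+1 = beven n + beven (n.+1)./2.
Proof.
rewrite {1}/beven mulnS !add2n bS b_odd -bE /beven /=.
by rewrite mul2n odd_double /= doubleK.
Qed.

Lemma beven_sumS n : beven_sum n.+1 = beven_sum n + beven n.+1.
Proof. by rewrite /beven_sum big_ord_recr. Qed.

Lemma beven_sum2S n : beven_sum2 n.+1 = beven_sum2 n + beven_sum n.+1.
Proof. by rewrite /beven_sum2 big_ord_recr. Qed.

Lemma beven_sum0 : beven_sum 0 = 1.  Proof. by rewrite /beven_sum big_ord1 beven0. Qed.
Lemma beven_sum2_0 : beven_sum2 0 = 1.  Proof. by rewrite /beven_sum2 big_ord1 beven_sum0. Qed.

(** In the recurrence [bevenS], the value at [k] is the increment at both [k.*2] and [k.*2.+1], so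
    the increments add up to twice a partial sum. *)
Lemma beven_double n : beven n.*2 + beven n = 2 * beven_sum n /\ beven n.*2.+1 = 2 * beven_sum n.
Proof.
have h k : beven k.*2.+1 = beven k.*2 + beven k by rewrite bevenS /= uphalf_double.
elim: n => [|n [IH1 IH2]].
  by rewrite h -[0.*2]/0 beven_sum0 beven0.
rewrite h beven_sumS doubleS bevenS /= half_double; lia.
Qed.

Lemma beven_odd n : beven n.*2.+1 = 2 * beven_sum n.
Proof. by case: (beven_double n). Qed.

Lemma beven_even n : beven n.*2 + beven n = 2 * beven_sum n.
Proof. by case: (beven_double n). Qed.

(** The terms of indices [k.*2] and [k.*2.+1] add up to [4 * beven_sum k - beven k]; sum this over
    [k <= n]. *)
Lemma beven_sum_odd n : beven_sum n.*2.+1 + beven_sum n = 4 * beven_sum2 n.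
Proof.
elim: n => [|n IH]; first by rewrite -[0.*2]/0 beven_sumS beven_sum0 beven_sum2_0 bevenS beven0.
rewrite doubleS beven_sumS beven_sumS beven_sum2S.
have := beven_even n.+1; have := beven_odd n.+1; rewrite doubleS => -> .
have := beven_sumS n; lia.
Qed.

Lemma beven_sum_even n : beven_sum n.*2 + 3 * beven_sum n = 4 * beven_sum2 n.
Proof. by have := beven_sum_odd n; rewrite beven_sumS beven_odd; lia. Qed.

Lemma s2_digits K n : n <= K -> s2 n = \sum_(i < K) (n %/ 2 ^ i) %% 2.
Proof.
move=> nK; rewrite /s2 -!(big_mkord xpredT (fun i => (n %/ 2 ^ i) %% 2)).
rewrite [RHS](big_cat_nat (n := n)) //= [X in _ + X]big1_seq ?addn0 // => i.
rewrite mem_index_iota => /andP[_ /andP[ni _]].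
by rewrite divn_small // (leq_ltn_trans ni) // ltn_expl.
Qed.

Lemma s2_bit (c : bool) n : s2 (c + n.*2) = c + s2 n.
Proof.
rewrite (@s2_digits (n.*2.+2)) 1?big_ord_recl; last by case: c; lia.
rewrite expn0 divn1 modn2 oddD odd_double addbF oddb; congr (_ + _).
rewrite (@s2_digits n.*2.+1); last by lia.
apply: eq_bigr => i _; rewrite lift0 expnS divnMA.
by congr ((_ %/ _) %% 2); case: c; lia.
Qed.

Lemma t_even n : t n.*2 = t n.
Proof. by rewrite /t (s2_bit false). Qed.

Lemma t_odd n : t n.*2.+1 = (- t n)%R.
Proof. by rewrite /t (s2_bit true) exprS mulN1r. Qed.

Lemma t_cases n : t n = 1%R \/ t n = (-1)%R.
Proof. by rewrite /t -signr_odd; case: odd; [right|left]. Qed.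

Lemma T_t n : (T n == 1) = (t n == -1)%R.
Proof. by rewrite /T /t modn2 -signr_odd; case: odd. Qed.

(** Stated conditionally so that the strong induction in [beven_sum_mod8] can apply it to smaller
    indices. *)
Lemma odd_beven_sum2_of r :
  (forall k, k <= r -> odd (beven_sum k)) -> odd (beven_sum2 r) = ~~ odd r.
Proof.
elim: r => [|r IH] h; first by rewrite beven_sum2_0.
rewrite beven_sum2S oddD h // IH ?addbT //.
by move=> k kr; apply: h; apply: leqW.
Qed.

(** Modulo 8 only the parity of [beven_sum2 r./2] matters in the doubling identities. For odd [r]
    they flip the sign; for even [r], [-3 * t k = t k + 4] modulo 8. *)
Lemma beven_sum_mod8 r : ((beven_sum r)%:Z = t r + 4 * r%:Z %[mod 8])%Z.
Proof.
elim/ltn_ind: r => r IH.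
case: (posnP r) => [->|r0]; first by rewrite beven_sum0 /t /s2 big_ord0.
have hR : odd (beven_sum2 r./2) = ~~ odd r./2.
  apply: odd_beven_sum2_of => k kr; have kr' : k < r by lia.
  have := IH k kr'; case: (t_cases k) => ->; lia.
have hr : r./2 < r by lia.
have := IH _ hr; have := beven_sum_odd r./2; have := beven_sum_even r./2.
move: hR; rewrite -[in t r](odd_double_half r) -[in beven_sum r](odd_double_half r).
by case: (boolP (odd r)) => or; rewrite ?add0n ?add1n ?t_odd ?t_even;
  case: (t_cases r./2) => ->; lia.
Qed.

Lemma odd_beven_sum r : odd (beven_sum r).
Proof. by have := beven_sum_mod8 r; case: (t_cases r) => ->; lia. Qed.

Lemma odd_beven_sum2 r : odd (beven_sum2 r) = ~~ odd r.
Proof. by apply: odd_beven_sum2_of => k _; apply: odd_beven_sum. Qed.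

(** Modulo 4, [beven_sum2] grows from [2 * r] to [2 * r + 2] by [beven_sum r.+1 - beven_sum r], so
    the congruence telescopes. *)
Lemma beven_sum2_double r : beven_sum2 r.*2 = beven_sum r %[mod 4].
Proof.
elim: r => [|r IH]; first by rewrite -[0.*2]/0 beven_sum2_0 beven_sum0.
rewrite doubleS !beven_sum2S.
have := beven_sum_odd r; have := beven_sum_even r.+1; rewrite doubleS !beven_sum2S.
have := odd_beven_sum r; have := odd_beven_sum r.+1; lia.
Qed.

(** The doubling identities give [8 * beven_sum2 (2 * r) - 4 * beven_sum (2 * r)], which is
    [20 * beven_sum r - 16 * beven_sum2 r] modulo 32. *)
Lemma beven_8n2 r : ((beven (8 * r + 2))%:Z = 4 * t r %[mod 32])%Z.
Proof.
have -> : 8 * r + 2 = (r.*2.*2.+1).*2 by lia.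
have := beven_even (r.*2.*2.+1); have := beven_odd r.*2; have := beven_sum_odd r.*2.
have := beven_sum_even r; have := beven_sum2_double r.
have := odd_beven_sum2 r; have := beven_sum_mod8 r.
by case: (t_cases r) => ->; lia.
Qed.

Lemma beven_8n6 r : ((beven (8 * r + 6))%:Z = 4 * t r + 16 %[mod 32])%Z.
Proof.
have -> : 8 * r + 6 = (r.*2.+1.*2.+1).*2 by lia.
have := beven_even (r.*2.+1.*2.+1); have := beven_odd r.*2.+1; have := beven_sum_odd r.*2.+1.
have := beven_sum_odd r; have := beven_sum2_double r.
have := beven_sum2S r.*2; have := odd_beven_sum2 r.
by have := beven_sum_mod8 r; case: (t_cases r) => ->; lia.
Qed.

Lemma beven_4n n : beven (4 * n) + 8 * beven_sum n = 8 * beven_sum2 n + beven n.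
Proof.
have -> : 4 * n = n.*2.*2 by lia.
have := beven_even n.*2; have := beven_even n; have := beven_sum_even n; lia.
Qed.

Lemma beven_odd_mod4 n : odd n -> beven n = 2 %[mod 4].
Proof.
move=> n_odd; rewrite -(odd_double_half n) n_odd add1n beven_odd.
have := odd_beven_sum n./2; lia.
Qed.

(** After division by 4, the residue 28 becomes 7 modulo 8, whereas 4, 12 and 20 become 1, 3 and 5,
    which [three_squares] covers. *)
Lemma beven_chi n : 0 < n ->
  if chi n == 1 then beven n = 28 %[mod 32]
  else beven n = 2 %[mod 4] \/ beven n %% 32 \in [:: 4; 12; 20].
Proof.
have [_ chi_odd chi_4n chi_8n2 chi_8n6] := chi_satisfies.
elim/ltn_ind: n => n IH n0.
have [n_odd|n_even] := boolP (odd n).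
  have -> : n = 2 * n./2 + 1 by lia.
  by rewrite chi_odd; left; apply: beven_odd_mod4; lia.
have [m4|m4] := eqVneq (n %% 4) 0.
  have [m e] : exists m, n = 4 * m by exists (n %/ 4); lia.
  have [m0 mn] : 0 < m /\ m < n by lia.
  have := IH m mn m0; rewrite e chi_4n.
  have hA := beven_4n m.
  have [m_odd|m_even] := boolP (odd m).
    have -> : m = 2 * m./2 + 1 by lia.
    rewrite chi_odd => _; left; have := beven_odd_mod4 m_odd.
    have -> : 2 * m./2 + 1 = m by lia.
    lia.
  (* For even [m] the difference [8 * (beven_sum2 m - beven_sum m)] vanishes modulo 32: both sums
     are [beven_sum m./2] modulo 4. *)
  have -> : beven (4 * m) %% 32 = beven m %% 32.
    have := beven_sum2_double m./2; have := beven_sum_mod8 m; have := beven_sum_mod8 m./2.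
    rewrite -[in t m](odd_double_half m) (negbTE m_even) t_even.
    have -> : m./2.*2 = m by lia.
    by case: (t_cases m./2) => ->; lia.
  case: ifP => // _ [h|h]; [left|by right]; lia.
have [r e] : exists r, n = 8 * r + 2 \/ n = 8 * r + 6.
  by exists (n %/ 8); lia.
case: e => ->.
  rewrite chi_8n2 T_t; have := beven_8n2 r; case: (t_cases r) => -> /= h.
    by right; have -> : beven (8 * r + 2) %% 32 = 4 by lia.
  by lia.
rewrite chi_8n6 /=; have := beven_8n6 r; case: (t_cases r) => -> h; right.
  by have -> : beven (8 * r + 6) %% 32 = 20 by lia.
by have -> : beven (8 * r + 6) %% 32 = 12 by lia.
Qed.

(** * Ternary forms of determinant 1 *)

Local Open Scope ring_scope.

(* The Gram matrix is ((a, r, q), (r, b, p), (q, p, c)). *)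
Definition ternary (a b c p q r x y z : int) : int :=
  a * x ^+ 2 + b * y ^+ 2 + c * z ^+ 2
  + 2 * p * y * z + 2 * q * x * z + 2 * r * x * y.

Definition ternary_det (a b c p q r : int) : int :=
  a * b * c + 2 * p * q * r - a * p ^+ 2 - b * q ^+ 2 - c * r ^+ 2.

Lemma nearest_multiple (A B : int) : 0 < A -> exists k, 2 * `|B + k * A| <= A.
Proof.
move=> A0; exists (- ((2 * B + A) %/ (2 * A))%Z).
have h : 2 * A != 0 by lia.
have := divz_eq (2 * B + A) (2 * A); have := modz_ge0 (2 * B + A) h.
have : ((2 * B + A) %% (2 * A) < 2 * A)%Z by apply: ltz_pmod; lia.
move: ((2 * B + A) %% (2 * A))%Z ((2 * B + A) %/ (2 * A))%Z => m d; nia.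
Qed.

Lemma half_bound_sqr (A B : int) : 2 * `|B| <= A -> 4 * B ^+ 2 <= A ^+ 2.
Proof.
move=> BA; rewrite -(real_normK (num_real B)) (_ : 4 * _ = (2 * `|B|) ^+ 2); last by ring.
by rewrite lerXn2r // ?nnegrE; lia.
Qed.

(* Hermite reduction: a f = (ax + ry + qz)^2 + g(y, z), where the binary form g
   has determinant a and leading coefficient A = ab - r^2.  Once g and r are
   reduced, 3 A^2 <= 4 a and 3 a^2 <= 4 A, which forces a = 1. *)
Lemma ternary_det1_sum3sq (a b c p q r x y z : int) :
  0 < a -> 0 < a * b - r ^+ 2 -> ternary_det a b c p q r = 1 ->
  sum_of_three_squares (ternary a b c p q r x y z).
Proof.
(* Lexicographic induction on [a], then on [a * b - r ^+ 2]: exchanging two variables lowers one of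
   them whenever the form is not yet reduced. *)
have [n] := ubnP `|a|%N; elim: n a b c p q r x y z => // n IHn a b c p q r x y z.
move=> an; have [m] := ubnP (absz (a * b - r ^+ 2)%R).
elim: m a b c p q r x y z an => // m IHm a b c p q r x y z an Am a0 A0 det1.
have [k hk] := nearest_multiple (a * p - q * r) A0.
pose p1 := p + k * b; pose q1 := q + k * r; pose c1 := c + 2 * p * k + b * k ^+ 2.
have -> : ternary a b c p q r x y z = ternary a b c1 p1 q1 r x (y - k * z) z.
  by rewrite /ternary /p1 /q1 /c1; ring.
have {}det1 : ternary_det a b c1 p1 q1 r = 1.
  by rewrite -det1 /ternary_det /p1 /q1 /c1; ring.
have B1 : 2 * `|a * p1 - q1 * r| <= a * b - r ^+ 2.
  by rewrite (_ : a * p1 - q1 * r = a * p - q * r + k * (a * b - r ^+ 2))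
    // /p1 /q1; ring.
move: (y - _) c1 p1 q1 det1 B1 {hk} => {}y {}c {}p {}q det1 B1 {k}.
have disc : (a * b - r ^+ 2) * (a * c - q ^+ 2) - (a * p - q * r) ^+ 2 = a.
  by rewrite -[RHS]mulr1 -det1 /ternary_det; ring.
have C0 : 0 < a * c - q ^+ 2.
  by rewrite -(pmulr_rgt0 _ A0); nia.
have [CA|AC] := ltP (a * c - q ^+ 2) (a * b - r ^+ 2).
  have -> : ternary a b c p q r x y z = ternary a c b p r q x z y.
    by rewrite /ternary; ring.
  apply: IHm => //; first by lia.
  by rewrite -det1 /ternary_det; ring.
have [k hk] := nearest_multiple r a0.
pose p1 := p + k * q; pose r1 := r + k * a; pose b1 := b + 2 * r * k + a * k ^+ 2.
have eA : a * b - r ^+ 2 = a * b1 - r1 ^+ 2 by rewrite /b1 /r1; ring.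
have eB : a * p - q * r = a * p1 - q * r1 by rewrite /p1 /r1; ring.
have -> : ternary a b c p q r x y z = ternary a b1 c p1 q r1 (x - k * y) y z.
  by rewrite /ternary /p1 /r1 /b1; ring.
have {}det1 : ternary_det a b1 c p1 q r1 = 1.
  by rewrite -det1 /ternary_det /p1 /r1 /b1; ring.
rewrite -/r1 in hk; rewrite eA eB in A0 B1 disc AC {Am}.
clear eA eB C0; move: (x - _) b1 p1 r1 hk A0 B1 disc AC det1.
move=> {}x {}b {}p {}r hk A0 B1 disc AC det1 {k}.
have [ba|ab] := ltP b a.
  have -> : ternary a b c p q r x y z = ternary b a c q p r y x z.
    by rewrite /ternary; ring.
  have b0 : 0 < b by rewrite -(pmulr_rgt0 _ a0); have := sqr_ge0 r; lia.
  apply: IHn => //; try by lia.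
  by rewrite -det1 /ternary_det; ring.
set A := a * b - r ^+ 2 in A0 B1 disc AC *.
have h1 : 3 * A ^+ 2 <= 4 * a.
  have := half_bound_sqr B1; have : A ^+ 2 <= A * (a * c - q ^+ 2).
    by rewrite expr2 ler_pM2l.
  by lia.
have a1 : a = 1.
  have h2 : 3 * a ^+ 2 <= 4 * A.
    have := half_bound_sqr hk; have : a ^+ 2 <= a * b by rewrite expr2 ler_pM2l.
    by rewrite /A; lia.
  (* If [2 <= a], the two bounds give [27 * a ^+ 3 <= 64], contrary to [8 <= a ^+ 3]. *)
  have [//|a2] : a = 1 \/ 2 <= a by lia.
  have h3 : (3 * a ^+ 2) ^+ 2 <= (4 * A) ^+ 2.
    by rewrite lerXn2r // nnegrE; lia.
  have h4 : 8 <= a ^+ 3 by rewrite (_ : 8 = 2 ^+ 3) // lerXn2r // nnegrE; lia.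
  have h5 : a * 8 <= a * a ^+ 3 by rewrite ler_pM2l.
  have e4 : (3 * a ^+ 2) ^+ 2 = 9 * (a * a ^+ 3) by ring.
  have e5 : (4 * A) ^+ 2 = 16 * A ^+ 2 by ring.
  move: h1 h3 h5 {h2 h4 B1 disc AC det1 hk A0}; rewrite e4 e5.
  by move: (a * a ^+ 3) (A ^+ 2) => u v; lia.
have r0 : r = 0 by lia.
rewrite /A a1 r0 in h1 A0 B1 det1.
have b1 : b = 1 by nia.
rewrite b1 in B1 det1; have p0 : p = 0 by lia.
rewrite /ternary_det p0 in det1; have c1 : c = 1 + q ^+ 2 by lia.
by exists (x + q * z), y, z; rewrite /ternary a1 r0 b1 p0 c1; ring.
Qed.

(* The binary form (m, B, C) of determinant N is the one complementary to N in
   the matrix ((N, u, v), (u, g, a12), (v, a12, a22)). *)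
Lemma sum3sq_of_residues (N m : nat) (u B : int) :
  (0 < N)%N -> (0 < m)%N -> coprime m N ->
  (N%:Z %| m%:Z + u ^+ 2)%Z -> (m%:Z %| N%:Z + B ^+ 2)%Z ->
  sum_of_three_squares N%:Z.
Proof.
move=> N0 m0 mN /dvdzP[g /eqP]; rewrite [_ * N%:Z]mulrC => /eqP hg.
move=> /dvdzP[C /eqP]; rewrite mulrC => /eqP hC.
have [w [e we]] : exists w e, m%:Z * w = 1 + N%:Z * e.
  have [w [e we]] := Bezoutz m%:Z N%:Z; exists w, (- e).
  move: mN; rewrite /coprime => /eqP mN.
  by move: we; rewrite /gcdz /= mN => we; lia.
(* As [w] inverts [m] modulo [N], this [v] makes [N] divide [B + u * v] and [C + v ^+ 2]; [a12] and
   [a22] are the quotients. *)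
pose v := u * B * w.
pose a12 := g * B * w - e * B.
pose a22 := (g * m%:Z * C - g * N%:Z + m%:Z) * w ^+ 2 - C * (2 * e + N%:Z * e ^+ 2).
have h12 : N%:Z * a12 = B + u * v.
  have -> : u * v = (m%:Z + u ^+ 2) * B * w - m%:Z * w * B by rewrite /v; ring.
  by rewrite we hg /a12; ring.
have h22 : N%:Z * a22 = C + v ^+ 2.
  have -> : v ^+ 2 = (m%:Z + u ^+ 2) * (N%:Z + B ^+ 2) * w ^+ 2
     - m%:Z * (N%:Z + B ^+ 2) * w ^+ 2 - N%:Z * (m%:Z + u ^+ 2) * w ^+ 2
     + m%:Z * N%:Z * w ^+ 2 by rewrite /v; ring.
  rewrite hg hC.
  have -> : m%:Z * (m%:Z * C) * w ^+ 2 = (m%:Z * w) ^+ 2 * C by ring.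
  by rewrite we /a22; ring.
have det1 : ternary_det N%:Z g a22 a12 v u = 1.
  have N1 : N%:Z != 0 by rewrite eqz_nat -lt0n.
  apply: (mulfI N1); rewrite mulr1 /ternary_det.
  transitivity ((N%:Z * g - u ^+ 2) * (N%:Z * a22 - v ^+ 2)
                - (N%:Z * a12 - u * v) ^+ 2); first by ring.
  rewrite h12 h22 -hg; transitivity (m%:Z * C - B ^+ 2); first by ring.
  by rewrite -hC; ring.
have -> : N%:Z = ternary N%:Z g a22 a12 v u 1 0 0 by rewrite /ternary; ring.
apply: ternary_det1_sum3sq => //.
by rewrite -hg; lia.
Qed.

Local Close Scope ring_scope.

(** * The quadratic character of -N *)

Definition abs_res (n x : nat) : nat := minn (x %% n) (n - x %% n).

(** For odd [n], the sign of the residue of least absolute value; multiples of [n] get 1. *)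
Definition res_sign (n x : nat) : int := ((-1) ^+ (n < 2 * (x %% n)))%R.

(* The Jacobi symbol (a/n), for n odd and coprime to a, in the form of Gauss's
   lemma. *)
Definition gauss_symbol (a n : nat) : int :=
  (\prod_(j < n./2) res_sign n (a * j.+1))%R.

Lemma res_sign_sqr n x : (res_sign n x * res_sign n x = 1)%R.
Proof. by rewrite /res_sign; case: (_ < _). Qed.

Lemma res_sign_dvd n x : n %| x -> res_sign n x = 1%R.
Proof. by rewrite /res_sign => /eqP->. Qed.

Lemma res_sign_opp n x y : odd n -> n %| x + y -> ~~ (n %| x) ->
  res_sign n y = (- res_sign n x)%R.
Proof.
move=> n_odd nxy nx; have n0 := odd_gt0 n_odd.
have hx := ltn_pmod x n0; have hy := ltn_pmod y n0.
have e : x %% n + y %% n = n.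
  have : n %| x %% n + y %% n by rewrite /dvdn modnDm.
  rewrite /dvdn in nx; move: (x %% n) (y %% n) nx hx hy => u v nu hu hv.
  by case/dvdnP => -[|[|k]]; nia.
rewrite /res_sign; have -> : y %% n = n - x %% n by lia.
move: (x %% n) hx {e} => u hu.
have -> : (n < 2 * (n - u)) = ~~ (n < 2 * u) by lia.
by case: (n < 2 * u); rewrite ?expr1 ?expr0 ?opprK.
Qed.

Lemma res_sign_small n j : j < n./2 -> res_sign n j.+1 = 1%R.
Proof. by move=> jn; rewrite /res_sign modn_small; [case: ltnP => //; lia | lia]. Qed.

Section HalfSystem.

Variables (A : comPzRingType) (n : nat) (e : nat -> A).
Hypotheses (n_odd : odd n) (e_even : forall x y, n %| x + y -> e x = e y).

Lemma even_modn x : e x = e (x %% n).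
Proof.
have n0 := odd_gt0 n_odd.
have hx := ltn_pmod x n0.
rewrite (@e_even x (n - x %% n)); last first.
  by rewrite {1}(divn_eq x n) -addnA dvdn_addr ?dvdn_mull // subnKC // ltnW.
by symmetry; apply: e_even; rewrite subnKC // ltnW.
Qed.

Lemma even_abs_res x : e x = e (abs_res n x).
Proof.
have n0 := odd_gt0 n_odd.
have hx := ltn_pmod x n0.
rewrite even_modn /abs_res; case: (leqP (x %% n) (n - x %% n)) => // _.
by apply: e_even; rewrite subnKC // ltnW.
Qed.

(** Up to sign, multiplication by [a] permutes the residues from 1 to [n./2], and [e] ignores
    signs. *)
Lemma half_system_prod a : coprime a n ->
  (\prod_(j < n./2) e (a * j.+1) = \prod_(j < n./2) e j.+1)%R.
Proof.
move=> an; have n0 := odd_gt0 n_odd.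
case: (posnP n./2) => [->|h0]; first by rewrite !big_ord0.
have ndvd (j : 'I_n./2) : ~~ (n %| a * j.+1).
  rewrite Gauss_dvdr 1?coprime_sym // gtnNdvd //.
  by have := ltn_ord j; lia.
have bound (j : 'I_n./2) : 0 < abs_res n (a * j.+1) <= n./2.
  have := ltn_pmod (a * j.+1) n0; have := ndvd j.
  by rewrite /dvdn /abs_res; move: (_ %% n) => r; lia.
have lt (j : 'I_n./2) : (abs_res n (a * j.+1)).-1 < n./2.
  by have := bound j; lia.
pose f j : 'I_n./2 := Ordinal (lt j).
have finj : injective f.
  move=> i j /(congr1 val) /= eij.
  have {}eij : abs_res n (a * i.+1) = abs_res n (a * j.+1).
    by have := bound i; have := bound j; lia.
  have [h|h] : a * i.+1 = a * j.+1 %[mod n] \/ n %| a * i.+1 + a * j.+1.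
    rewrite /dvdn -modnDm; move: eij; rewrite /abs_res.
    have := ltn_pmod (a * i.+1) n0; have := ltn_pmod (a * j.+1) n0.
    have := ndvd i; have := ndvd j; rewrite /dvdn.
    move: (_ %% n) (_ %% n) => u v; move=> v0 u0 vn un.
    case: (u =P v) => [|ne] E; first by left.
    by right; have -> : u + v = n; [lia | rewrite modnn].
  - wlog ij : i j {eij} h / i <= j.
      by case: (leqP i j) => ij; [apply | move=> H; apply/esym/H => //; lia].
    move/esym/eqP: h; rewrite eqn_mod_dvd ?leq_mul2l ?ltnS ?ij ?orbT //.
    rewrite -mulnBr Gauss_dvdr 1?coprime_sym // subSS => h.
    have := ltn_ord j; case: (posnP (j - i)) => [ji0|ji] hj.
      by apply/val_inj => /=; lia.
    by move: h; rewrite gtnNdvd //; lia.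
  move: h; rewrite -mulnDr Gauss_dvdr 1?coprime_sym // gtnNdvd //.
  by have := ltn_ord i; have := ltn_ord j; lia.
rewrite [RHS](reindex_inj finj) /=; apply: eq_bigr => j _.
have /prednK-> : 0 < abs_res n (a * j.+1) by case/andP: (bound j).
exact: even_abs_res.
Qed.

End HalfSystem.

Lemma prod_centered (A : comPzRingType) (E : nat -> A) c h : h <= c ->
  (\prod_(c - h <= x < c + h.+1) E x =
   E c * \prod_(i < h) (E (c - i.+1)%N * E (c + i.+1)%N))%R.
Proof.
elim: h => [|h IH] hc; first by rewrite subn0 addn1 big_nat1 big_ord0 mulr1.
rewrite addnS big_nat_recr /=; last by lia.
rewrite big_ltn; last by lia.
have -> : (c - h.+1).+1 = c - h by lia.
by rewrite IH 1?ltnW // big_ord_recr /=; ring.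
Qed.

(** After the initial half block, the range consists of blocks centred at multiples of [n], where
    factors at equal distance from the centre cancel. *)
Lemma prod_block (A : comPzRingType) (E : nat -> A) n K : odd n ->
  (forall x y, n %| x + y -> ~~ (n %| x) -> (E x * E y = 1)%R) ->
  (\prod_(x < n * K + n./2) E x.+1 =
   (\prod_(k < K) E (n * k.+1)%N) * \prod_(x < n./2) E x.+1)%R.
Proof.
move=> n_odd hE; elim: K => [|K IH].
  by rewrite muln0 big_ord0 mul1r.
rewrite big_ord_recr /= mulrAC -IH.
rewrite -!(big_mkord xpredT (fun x => E x.+1)).
rewrite (big_cat_nat (n := n * K + n./2)) //=; last by lia.
congr (_ * _)%R.
transitivity (\prod_((n * K + n./2).+1 <= x < (n * K.+1 + n./2).+1) E x)%R.
  by rewrite big_add1.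
have -> : (n * K + n./2).+1 = n * K.+1 - n./2 by lia.
have -> : (n * K.+1 + n./2).+1 = n * K.+1 + (n./2).+1 by lia.
rewrite prod_centered; last by lia.
rewrite big1 ?mulr1 // => i _; apply: hE.
  have -> : n * K.+1 - i.+1 + (n * K.+1 + i.+1) = 2 * K.+1 * n.
    by have := ltn_ord i; lia.
  by rewrite dvdn_mull.
have -> : n * K.+1 - i.+1 = n * K + (n - i.+1) by have := ltn_ord i; lia.
by rewrite dvdn_addr ?dvdn_mulr // gtnNdvd //; have := ltn_ord i; lia.
Qed.

(* Any odd sign function modulo [n * n'] computes the symbol; choosing the sign
   of x mod n, and that of x / n mod n' when n divides x, makes it factor. *)
Lemma gauss_symbolMr a n n' : odd n -> odd n' -> coprime a n -> coprime a n' ->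
  gauss_symbol a (n * n') = (gauss_symbol a n * gauss_symbol a n')%R.
Proof.
move=> n_odd n_odd' an an'; set m := n * n'.
have m_odd : odd m by rewrite oddM n_odd.
have am : coprime a m by rewrite coprimeMr an.
have [n0 n0'] := (odd_gt0 n_odd, odd_gt0 n_odd').
pose s x := if n %| x then res_sign n' (x %/ n) else res_sign n x.
have s_sqr x : (s x * s x = 1)%R by rewrite /s; case: ifP => _; apply: res_sign_sqr.
have dvdn_sum x y : n %| x + y -> (n %| y) = (n %| x).
  move=> nxy; apply/idP/idP => h.
    by move: nxy; rewrite dvdn_addl.
  by move: nxy; rewrite dvdn_addr.
have s_opp x y : m %| x + y -> ~~ (m %| x) -> s y = (- s x)%R.
  move=> mxy mx; have nxy : n %| x + y by apply: dvdn_trans mxy; apply: dvdn_mulr.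
  rewrite /s (dvdn_sum x y) //; case: ifP => [nx|/negbT nx]; last exact: res_sign_opp.
  have ny : n %| y by rewrite (dvdn_sum x).
  apply: res_sign_opp => //.
    by rewrite -divnDl // dvdn_divRL // mulnC.
  by rewrite dvdn_divRL // mulnC.
have s_dvd x : m %| x -> s x = 1%R.
  move=> mx; have nx : n %| x by apply: dvdn_trans mx; apply: dvdn_mulr.
  by rewrite /s nx res_sign_dvd // dvdn_divRL // mulnC.
have -> : gauss_symbol a m = (\prod_(x < m./2) (s (a * x.+1)%N * s x.+1))%R.
  (* [e] is even modulo [m], so [half_system_prod] trades the symbol for a product of values of
     [s]. *)
  pose e x := (s x * res_sign m x)%R.
  have e_even x y : m %| x + y -> e x = e y.
    move=> mxy; rewrite /e; have [mx|mx] := boolP (m %| x).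
      have my : m %| y by move: mxy; rewrite dvdn_addr.
      by rewrite !s_dvd ?res_sign_dvd.
    by rewrite (s_opp x y) // (res_sign_opp m_odd mxy) // mulrNN.
  have := half_system_prod m_odd e_even am; rewrite /e !big_split /=.
  rewrite [X in (_ * X = _)%R -> _](_ : _ = gauss_symbol a m) //.
  rewrite [X in (_ = _ * X)%R -> _]big1; last first.
    by move=> i _; apply: res_sign_small.
  rewrite mulr1 => <-; rewrite mulrA -big_split big1 ?mul1r // => i _.
  exact: s_sqr.
have -> : m./2 = n * n'./2 + n./2 by rewrite /m; nia.
(* Multiples of [n] in the half range contribute the symbol modulo [n'], the initial half block the
   one modulo [n]. *)
rewrite (prod_block (E := fun x => s (a * x)%N * s x)%R) //; last first.
  move=> x y nxy nx; have ny : n %| y = false by rewrite (dvdn_sum x) // (negbTE nx).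
  have nax : n %| a * x = false by rewrite Gauss_dvdr 1?coprime_sym ?(negbTE nx).
  have nay : n %| a * y = false by rewrite Gauss_dvdr 1?coprime_sym ?ny.
  rewrite /s nax nay (negbTE nx) ny (res_sign_opp n_odd nxy) //.
  rewrite (@res_sign_opp _ (a * x) (a * y)) ?nax -?mulnDr ?dvdn_mull //.
  by rewrite mulrNN mulrACA !res_sign_sqr mulr1.
rewrite mulrC; congr (_ * _)%R; apply: eq_bigr => i _.
  have nx : n %| i.+1 = false by rewrite gtnNdvd //; have := ltn_ord i; lia.
  rewrite /s Gauss_dvdr 1?coprime_sym // nx.
  by rewrite [X in (_ * X)%R]res_sign_small ?mulr1.
rewrite /s mulnCA !dvdn_mulr // !mulKn //.
by rewrite [X in (_ * X)%R]res_sign_small ?mulr1.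
Qed.

Lemma res_sign_divn n x : odd n -> res_sign n x = ((-1) ^+ (2 * x %/ n))%R.
Proof.
move=> n_odd; have n0 := odd_gt0 n_odd; have hx := ltn_pmod x n0.
rewrite {2}(divn_eq x n) mulnDr mulnA divnMDl // exprD exprM sqrrN !expr1n mul1r.
rewrite /res_sign; congr (_ ^+ _)%R.
move: (x %% n) hx => r hr.
case: ltnP => h; last by rewrite divn_small //; lia.
by have := divn_eq (2 * r) n; have := ltn_pmod (2 * r) n0; nia.
Qed.

Lemma sum_threshold x d h : 0 < d ->
  \sum_(j < h) (x <= d * j.+1) = h - x.-1 %/ d.
Proof.
move=> d0; elim: h => [|h IH]; first by rewrite big_ord0.
rewrite big_ord_recr /= IH.
have -> : (x <= d * h.+1) = (x.-1 %/ d <= h).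
  rewrite -[RHS]ltnS ltn_divLR // [h.+1 * d]mulnC; have : 0 < d * h.+1 by rewrite muln_gt0 d0.
  by move: (d * _) => y; lia.
by case: leqP; lia.
Qed.

Lemma sum_multiples y n K : 0 < n ->
  \sum_(i < K) (i.+1 * n <= y) = minn K (y %/ n).
Proof.
move=> n0; elim: K => [|K IH]; first by rewrite big_ord0 min0n.
rewrite big_ord_recr /= IH -leq_divRL //.
by case: (leqP K.+1 (y %/ n)); lia.
Qed.

(* Eisenstein's count: ⌊2aj/n⌋ is the number of 0 < i < a with in ≤ 2aj. *)
Lemma gauss_symbol_count a n : odd n ->
  gauss_symbol a n =
  ((-1) ^+ (\sum_(i < a.-1) (n./2 - (i.+1 * n).-1 %/ (2 * a))))%R.
Proof.
move=> n_odd; have n0 := odd_gt0 n_odd.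
case: (posnP a) => [->|a0].
  rewrite big_ord0 expr0 /gauss_symbol big1 // => i _.
  by rewrite mul0n res_sign_dvd.
rewrite /gauss_symbol.
under eq_bigr do rewrite res_sign_divn //.
rewrite -(big_morph (fun k => (-1) ^+ k)%R (exprD _) (expr0 _)).
congr (_ ^+ _)%R.
transitivity (\sum_(j < n./2) \sum_(i < a.-1) (i.+1 * n <= 2 * a * j.+1)).
  apply: eq_bigr => j _.
  rewrite sum_multiples // mulnA; apply/esym/minn_idPr.
  by rewrite -ltnS prednK // ltn_divLR //; have := ltn_ord j; nia.
rewrite exchange_big /=; apply: eq_bigr => i _.
by rewrite sum_threshold ?muln_gt0.
Qed.

(** Euler's form of quadratic reciprocity: in Eisenstein's count the term of index [i] changes by
    the even number [2 * a - 2 * i.+1]. *)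
Lemma gauss_symbol_period a n : 0 < a -> odd n ->
  gauss_symbol a (n + 4 * a) = gauss_symbol a n.
Proof.
move=> a0 n_odd; have n_odd' : odd (n + 4 * a) by lia.
rewrite !gauss_symbol_count //.
rewrite !(big_morph (fun k => (-1) ^+ k)%R (exprD _) (expr0 _)).
apply: eq_bigr => i _; have ia := ltn_ord i.
have -> : (n + 4 * a)./2 = n./2 + 2 * a by lia.
have -> : (i.+1 * (n + 4 * a)).-1 = (2 * i.+1) * (2 * a) + (i.+1 * n).-1.
  by have := odd_gt0 n_odd; nia.
rewrite divnMDl ?muln_gt0 ?a0 //.
have h : (i.+1 * n).-1 %/ (2 * a) <= n./2.
  by rewrite -ltnS ltn_divLR ?muln_gt0 ?a0 //; nia.
rewrite -[LHS]signr_odd -[RHS]signr_odd; congr (_ ^+ nat_of_bool _)%R; lia.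
Qed.

(** * Squares modulo a prime and the symbol of -N *)

Lemma euler_criterion (p : nat) (x : 'F_p) : prime p -> odd p ->
  (x ^+ p./2 = 1)%R -> exists y : 'F_p, (x = y ^+ 2)%R.
Proof.
move=> p_pr p_odd xp; have p1 := prime_gt1 p_pr.
have ep : p.-1 = p./2 * 2 by lia.
have [g g_prim] : exists g : 'F_p, p.-1.-primitive_root g.
  pose rs := enum [pred y : 'F_p | y != 0%R].
  have/hasP[g _ g_prim] : has p.-1.-primitive_root rs; last by exists g.
  apply: has_prim_root; rewrite ?enum_uniq //; first by lia.
    apply/allP => y; rewrite mem_enum inE unity_rootE => y0.
    have := expf_card y; rewrite card_Fp // -[X in (_ ^+ X)%R](ltn_predK p1) exprS.
    by rewrite -[RHS]mulr1 => /(mulfI y0)->.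
  have := cardC1 (0%R : 'F_p); rewrite card_Fp // -cardE => <-.
  by apply: eq_leq; apply: eq_card => y; rewrite !inE.
have xp1 : (x ^+ p.-1 = 1)%R by rewrite ep exprM xp expr1n.
have [[k _] /= ex] := prim_rootP g_prim xp1.
have : p.-1 %| k * p./2.
  by rewrite (prim_order_dvd g_prim) exprM -ex xp.
rewrite ep mulnC dvdn_pmul2r; last by lia.
by case/dvdnP => l ek; exists (g ^+ l)%R; rewrite ex ek exprM.
Qed.

(** The signed residue [e] is even, so its product over the half system is invariant under
    multiplication by [a]; cancelling the factorial leaves the symbol times the power equal to 1. *)
Lemma gauss_lemma (a p : nat) : prime p -> odd p -> coprime a p ->
  (a%:R ^+ p./2 = (gauss_symbol a p)%:~R :> 'F_p)%R.
Proof.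
move=> p_pr p_odd ap; have p0 := prime_gt0 p_pr.
pose e (x : nat) : 'F_p := ((res_sign p x)%:~R * x%:R)%R.
have e_even x y : p %| x + y -> e x = e y.
  move=> pxy; have : ((x + y)%:R = 0 :> 'F_p)%R.
    by apply/eqP; rewrite -(dvdn_pcharf (pchar_Fp p_pr)).
  rewrite natrD => /eqP; rewrite addrC addr_eq0 /e => /eqP->.
  have [px|px] := boolP (p %| x).
    have /eqP-> : (x%:R == 0 :> 'F_p)%R by rewrite -(dvdn_pcharf (pchar_Fp p_pr)).
    by rewrite oppr0 !mulr0.
  by rewrite (res_sign_opp p_odd pxy px) rmorphN /= mulrNN.
have := half_system_prod p_odd e_even ap; rewrite /e big_split /=.
rewrite -rmorph_prod /= -/(gauss_symbol a p).
under eq_bigr do rewrite natrM.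
rewrite big_split /= prodr_const card_ord.
under [in RHS]eq_bigr => i _ do rewrite res_sign_small // mul1r.
set P := (\prod_(i < _) _)%R => h.
have P0 : P != 0%R.
  apply/prodf_neq0 => i _; rewrite -(dvdn_pcharf (pchar_Fp p_pr)) gtnNdvd //.
  by have := ltn_ord i; lia.
have /(mulIf P0) {}h : ((gauss_symbol a p)%:~R * a%:R ^+ p./2 * P = 1 * P :> 'F_p)%R.
  by rewrite -mulrA h mul1r.
have sq : ((gauss_symbol a p)%:~R * (gauss_symbol a p)%:~R = 1 :> 'F_p)%R.
  rewrite -rmorphM /gauss_symbol -big_split big1 //= => i _.
  exact: res_sign_sqr.
by rewrite -[LHS]mul1r -[X in (X * _)%R]sq -mulrA h mulr1.
Qed.

(* The Jacobi symbol (-N/n). *)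
Definition chi_neg (N n : nat) : int :=
  if coprime n (4 * N) then ((-1) ^+ n./2 * gauss_symbol N n)%R else 0%R.

Lemma coprime4_odd n N : coprime n (4 * N) -> odd n.
Proof. by rewrite coprimeMr -[4]/(2 ^ 2) coprime_pexpr // coprimen2 => /andP[]. Qed.

Lemma chi_neg_sqr N n : coprime n (4 * N) -> (chi_neg N n * chi_neg N n = 1)%R.
Proof.
rewrite /chi_neg => ->; rewrite mulrACA -expr2 sqrr_sign mul1r.
rewrite /gauss_symbol -big_split big1 //= => i _; exact: res_sign_sqr.
Qed.

Lemma chi_negM N m n : chi_neg N (m * n) = (chi_neg N m * chi_neg N n)%R.
Proof.
rewrite /chi_neg coprimeMl.
case: (boolP (coprime m _)) => [mN|_] /=; last by rewrite mul0r.
case: (boolP (coprime n _)) => [nN|_] /=; last by rewrite mulr0.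
have [m_odd n_odd] := (coprime4_odd mN, coprime4_odd nN).
move: mN nN; rewrite !coprimeMr => /andP[_ mN] /andP[_ nN].
rewrite gauss_symbolMr 1?coprime_sym // mulrACA -exprD; congr (_ * _)%R.
by rewrite -[LHS]signr_odd -[RHS]signr_odd; congr (_ ^+ nat_of_bool _)%R; nia.
Qed.

Lemma chi_neg_period N n : 0 < N -> chi_neg N (n + 4 * N) = chi_neg N n.
Proof.
move=> N0; rewrite /chi_neg.
have -> : coprime (n + 4 * N) (4 * N) = coprime n (4 * N).
  by rewrite coprime_sym [RHS]coprime_sym /coprime addnC gcdnDl.
case: ifP => // nN; have n_odd := coprime4_odd nN.
rewrite gauss_symbol_period //; congr (_ * _)%R.
have -> : (n + 4 * N)./2 = n./2 + 2 * N by lia.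
by rewrite exprD exprM sqrrN !expr1n mulr1.
Qed.

Lemma chi_neg_prime N q : prime q -> chi_neg N q = 1%R ->
  exists B : int, (q%:Z %| (N%:Z + B ^+ 2)%R)%Z.
Proof.
move=> q_pr; rewrite /chi_neg; case: ifP => // qN chi1.
have q_odd := coprime4_odd qN.
have Nq : coprime N q by rewrite coprime_sym; move: qN; rewrite coprimeMr => /andP[].
have : ((- N%:R) ^+ q./2 = 1 :> 'F_q)%R.
  by rewrite exprNn gauss_lemma // -(rmorph_sign intr) -rmorphM chi1.
case/(euler_criterion q_pr q_odd) => y ey.
exists (Posz y).
have -> : (N%:Z + y%:Z ^+ 2 = (N + y ^ 2)%N%:Z)%R by rewrite PoszD -mulnn PoszM expr2.
have : ((N + y ^ 2)%:R == 0 :> 'F_q)%R.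
  by rewrite natrD natrX natr_Zp -ey addrN.
by rewrite -(dvdn_pcharf (pchar_Fp q_pr)).
Qed.

Lemma chi_neg_2Nm1 N : N %% 4 = 1 -> chi_neg N (2 * N - 1) = 1%R.
Proof.
move=> N4; have cop : coprime (2 * N - 1) (4 * N).
  have -> : 4 * N = 2 * (2 * N) by lia.
  rewrite coprimeMr coprimen2 subn1 coprimePn ?andbT; lia.
rewrite /chi_neg cop.
have -> : (2 * N - 1)./2 = 2 * (N - 1)./2 by lia.
rewrite exprM sqrrN !expr1n mul1r /gauss_symbol.
have -> : (2 * N - 1)./2 = 4 * (N %/ 4) by lia.
(* [N] inverts 2 modulo [2 * N - 1], so even multipliers have small residues and odd ones large
   residues. The signs alternate, and four consecutive ones multiply to 1. *)
transitivity (\prod_(j < 4 * (N %/ 4)) (-1) ^+ j.+1 : int)%R.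
  apply: eq_bigr => j _; have := ltn_ord j; rewrite /res_sign => jN.
  have [i [c ej]] : exists i (c : bool), j.+1 = 2 * i + c.
    by exists j.+1./2, (odd j.+1); lia.
  have e : N * j.+1 = i * (2 * N - 1) + (i + c * N) by nia.
  rewrite e modnMDl modn_small; last by case: (c) ej; lia.
  rewrite ej exprD exprM sqrrN !expr1n mul1r; congr (_ ^+ _)%R.
  by case: (c) ej; lia.
elim: (N %/ 4) => [|k IH]; first by rewrite big_ord0.
have -> : 4 * k.+1 = (4 * k).+4 by lia.
rewrite !big_ord_recr /= IH !exprS exprM.
have -> : ((-1) ^+ 4 = 1 :> int)%R by [].
by rewrite expr1n.
Qed.

(** [N] is 1 modulo [N - 1], so all signs in the symbol are 1, and [(N - 1)./2] is even. *)
Lemma chi_neg_Nm1 N : N %% 4 = 2 -> chi_neg N (N - 1) = 1%R.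
Proof.
move=> N4; have cop : coprime (N - 1) (4 * N).
  rewrite coprimeMr subn1 coprimePn ?andbT; last by lia.
  by rewrite -[4]/(2 ^ 2) coprimeXr // coprimen2; lia.
rewrite /chi_neg cop.
have -> : (N - 1)./2 = 2 * (N %/ 4) by lia.
rewrite exprM sqrrN !expr1n mul1r /gauss_symbol big1 // => i _.
have e : N * i.+1 = i.+1 * (N - 1) + i.+1 by nia.
rewrite /res_sign e modnMDl modn_small; last by have := ltn_ord i; lia.
by case: ltnP => //; have := ltn_ord i; lia.
Qed.

Lemma chi_neg_Nm2 N : N %% 8 = 3 -> chi_neg N (N - 2) = 1%R.
Proof.
move=> N8; have N_gt2 : 2 < N by lia.
have cop : coprime (N - 2) (4 * N).
  have := subnK (ltnW N_gt2); move: (N - 2) => m mN.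
  have m_odd : odd m by lia.
  rewrite coprimeMr -[4]/(2 ^ 2) coprimeXr // ?coprimen2 // -mN.
  by rewrite /coprime gcdnDl -/(coprime _ _) coprimen2.
rewrite /chi_neg cop.
have -> : (N - 2)./2 = 2 * (2 * (N %/ 8)) by lia.
rewrite exprM sqrrN !expr1n mul1r.
(* [N] is 2 modulo [N - 2], so the sign is -1 exactly on the upper half of the range, which has
   evenly many elements. *)
transitivity ((-1) ^+ (\sum_(j < 2 * (2 * (N %/ 8))) ((2 * (N %/ 8)).+1 <= 1 * j.+1)) : int)%R.
  rewrite (big_morph (fun k => (-1) ^+ k)%R (exprD _) (expr0 _)) /gauss_symbol.
  have -> : (N - 2)./2 = 2 * (2 * (N %/ 8)) by lia.
  apply: eq_bigr => j _; have := ltn_ord j => jN; congr (_ ^+ nat_of_bool _)%R.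
  have e : N * j.+1 = j.+1 * (N - 2) + 2 * j.+1 by nia.
  by rewrite e modnMDl modn_small; lia.
rewrite sum_threshold // divn1 /=.
have -> : 2 * (2 * (N %/ 8)) - 2 * (N %/ 8) = 2 * (N %/ 8) by lia.
by rewrite exprM sqrrN !expr1n.
Qed.

(** * Divisor sums of real characters *)

(** Real Dirichlet characters modulo [M], the principal one included. *)
Definition real_char (M : nat) (f : nat -> int) : Prop :=
  [/\ forall n, f (n + M) = f n,
      forall m n, f (m * n) = (f m * f n)%R
    & forall n, if coprime n M then (f n * f n = 1)%R else f n = 0%R].

Definition div_sum (f : nat -> int) (n : nat) : int := (\sum_(d <- divisors n) f d)%R.

Lemma real_char1 M f : real_char M f -> f 1 = 1%R.
Proof.
case=> _ fM fC; have := fC 1; rewrite coprime1n -[in f 1](muln1 1) fM => f1.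
have := fM 1 1; rewrite muln1; nia.
Qed.

Lemma real_char_cases M f n : real_char M f -> coprime n M -> f n = 1%R \/ f n = (-1)%R.
Proof.
case=> _ _ fC nM; have := fC n; rewrite nM -expr2 => /eqP.
by rewrite sqrf_eq1 => /orP[] /eqP ->; [left | right].
Qed.

Section DivSum.

Variables (M : nat) (f : nat -> int).
Hypothesis fchar : real_char M f.

Lemma div_sum1 : div_sum f 1 = 1%R.
Proof. by rewrite /div_sum (big_seq1 _ 1) (real_char1 fchar). Qed.

(** The divisors of [q ^ k.+1 * n] are those of [n] and [q] times those of [q ^ k * n]. *)
Lemma div_sum_primeX q e n : prime q -> ~~ (q %| n) -> 0 < n ->
  div_sum f (q ^ e * n) = ((\sum_(i < e.+1) f q ^+ i) * div_sum f n)%R.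
Proof.
have [_ fM _] := fchar.
move=> q_pr qn n0; have q0 := prime_gt0 q_pr.
have qX0 k : 0 < q ^ k * n by rewrite muln_gt0 expn_gt0 q0.
have step k : div_sum f (q ^ k.+1 * n) = (div_sum f n + f q * div_sum f (q ^ k * n))%R.
  rewrite /div_sum (bigID (fun d => q %| d)) /= addrC; congr (_ + _)%R.
    rewrite -big_filter; apply: perm_big; apply: uniq_perm.
    - by rewrite filter_uniq // divisors_uniq.
    - exact: divisors_uniq.
    move=> d; rewrite mem_filter -!dvdn_divisors //.
    apply/andP/idP => [[qd]|dn].
      by rewrite Gauss_dvdr // coprimeXr // coprime_sym prime_coprime.
    by split; [apply: contra qn => qd; apply: dvdn_trans dn | apply: dvdn_mull].
  rewrite -big_filter mulr_sumr.
  under [RHS]eq_bigr do rewrite -fM.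
  rewrite -(big_map (muln q) xpredT f); apply: perm_big; apply: uniq_perm.
  - by rewrite filter_uniq // divisors_uniq.
  - rewrite map_inj_uniq ?divisors_uniq // => x y /eqP.
    by rewrite eqn_pmul2l // => /eqP.
  move=> d; rewrite mem_filter -dvdn_divisors //.
  apply/andP/mapP => [[/dvdnP[c ->]]|[c]].
    rewrite expnS -mulnA [c * q]mulnC dvdn_pmul2l // => h.
    by exists c; rewrite // -dvdn_divisors.
  by rewrite -dvdn_divisors // => h ->; rewrite dvdn_mulr // expnS -mulnA dvdn_pmul2l.
elim: e => [|e IH]; first by rewrite mul1n big_ord1 expr0 mul1r.
rewrite step IH [in RHS]big_ord_recl /= expr0 mulrDl mul1r mulrA; congr (_ + _ * _)%R.
by rewrite mulr_sumr; apply: eq_bigr => i _; rewrite -exprS.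
Qed.

Lemma geometric_char q e : prime q ->
  ((0 <= \sum_(i < e.+1) f q ^+ i) /\
   (~~ odd e -> 0 < \sum_(i < e.+1) f q ^+ i) /\
   (odd e -> f q = -1 -> \sum_(i < e.+1) f q ^+ i = 0))%R.
Proof.
move=> q_pr; have := let: And3 _ _ h := fchar in h q.
case: ifP => [qM _|_ ->]; last first.
  rewrite big_ord_recl big1 ?addr0 // => i _.
  by rewrite /= exprS mul0r.
case: (real_char_cases fchar qM) => ->.
  under eq_bigr do rewrite expr1n.
  by rewrite sumr_const card_ord.
suff -> : (\sum_(i < e.+1) (-1) ^+ i = (~~ odd e)%:Z)%R by case: odd.
elim: e => [|e IH]; first by rewrite big_ord1.
by rewrite big_ord_recr IH /= -signr_odd /=; case: odd.
Qed.

Lemma prime_part_split n : 1 < n -> exists q e n',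
  [/\ prime q, ~~ (q %| n'), 0 < n', n' < n & n = q ^ e * n'].
Proof.
move=> n1; have q_pr := pdiv_prime n1.
have [n' qn' en] := pfactor_coprime q_pr (ltnW n1).
exists (pdiv n), (logn (pdiv n) n), n'; rewrite -prime_coprime //.
have n'0 : 0 < n' by case: n' en qn' => // en; move: n1; rewrite en.
split=> //; last by rewrite mulnC.
have e0 : 0 < logn (pdiv n) n by rewrite logn_gt0 mem_primes q_pr pdiv_dvd ltnW.
by rewrite [ltnRHS]en ltn_Pmulr // -(expn0 (pdiv n)) ltn_exp2l ?prime_gt1.
Qed.

Lemma div_sum_ge0 n : 0 < n -> (0 <= div_sum f n)%R.
Proof.
elim/ltn_ind: n => n IH n0; case: (leqP n 1) => n1.
  have -> : n = 1 by lia.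
  by rewrite div_sum1.
have [q [e [n' [q_pr qn' n'0 n'n ->]]]] := prime_part_split n1.
rewrite div_sum_primeX // mulr_ge0 ?IH //.
by case: (geometric_char e q_pr).
Qed.

(** All exponents in a square are even, so every geometric factor is a positive integer. *)
Lemma div_sum_sqr n : 0 < n -> (1 <= div_sum f (n ^ 2))%R.
Proof.
elim/ltn_ind: n => n IH n0; case: (leqP n 1) => n1.
  have -> : n = 1 by lia.
  by rewrite div_sum1.
have [q [e [n' [q_pr qn' n'0 n'n ->]]]] := prime_part_split n1.
rewrite expnMn -expnM div_sum_primeX ?expn_gt0 ?n'0 //; last first.
  by rewrite Euclid_dvdX ?negb_and ?qn'.
have [_ [h _]] := geometric_char (e * 2) q_pr.
have := h _; have := IH _ n'n n'0; rewrite oddM andbF => h1 /(_ isT) h2.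
nia.
Qed.

(** Some prime [q] with [g q = -1] has odd exponent in [n]; then [f q] is not 1, hence -1, and its
    geometric factor vanishes. *)
Lemma div_sum_eq0 (g : nat -> int) n : real_char M g -> 0 < n -> coprime n M ->
  (forall q, prime q -> q <= n -> coprime q M -> f q = 1%R -> g q = 1%R) ->
  (g n = -1)%R -> div_sum f n = 0%R.
Proof.
move=> gchar; have [_ gM _] := gchar.
elim/ltn_ind: n => n IH n0; case: (leqP n 1) => n1.
  have -> : n = 1 by lia.
  by rewrite (real_char1 gchar).
have [q [e [n' [q_pr qn' n'0 n'n en]]]] := prime_part_split n1.
move=> nM hq gn; rewrite en div_sum_primeX //.
move: nM gn; rewrite en gM coprimeMl => /andP[qM n'M].
case: (real_char_cases gchar n'M) => gn'; last first.
  move=> _; rewrite IH ?mulr0 // => p p_pr pn'; apply: hq => //.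
  by apply: leq_trans pn' _; apply: ltnW.
rewrite gn' mulr1 => gqe.
have gX k : g (q ^ k) = (g q ^+ k)%R.
  by elim: k => [|k IHk]; rewrite ?(real_char1 gchar) // expnS gM IHk exprS.
have e0 : 0 < e.
  by case: (e) gqe => //; rewrite (real_char1 gchar).
have {}qM : coprime q M by rewrite coprime_pexpl in qM.
have qn : q <= n.
  by apply: dvdn_leq => //; rewrite en dvdn_mulr // dvdn_exp.
move: gqe; rewrite gX; case: (real_char_cases gchar qM) => gq.
  by rewrite gq expr1n.
rewrite gq -signr_odd; case: (boolP (odd e)) => // e_odd _.
have [_ [_ h]] := geometric_char e q_pr; rewrite h ?mul0r //.
case: (real_char_cases fchar qM) => // fq.
by have := hq q q_pr qn qM fq; rewrite gq.
Qed.

End DivSum.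

(** * Dirichlet's hyperbola method *)

Lemma sum_multiples_reindex (A : nmodType) (F : nat -> A) a Y : 0 < a ->
  (\sum_(1 <= n < Y.+1 | (a %| n)%N) F n = \sum_(1 <= b < (Y %/ a).+1) F (a * b)%N)%R.
Proof.
move=> a0; rewrite -big_filter -(big_map (muln a) xpredT F).
apply: perm_big; apply: uniq_perm.
- by rewrite filter_uniq // iota_uniq.
- by rewrite map_inj_uniq ?iota_uniq // => x y /eqP; rewrite eqn_pmul2l // => /eqP.
move=> n; rewrite mem_filter mem_index_iota; apply/andP/mapP.
  case=> /dvdnP[b ->] /andP[ab0 abY]; exists b; last by rewrite mulnC.
  rewrite ltnS in abY; rewrite mem_index_iota ltnS leq_divRL // abY andbT.
  by case: (b) ab0.
case=> b; rewrite mem_index_iota ltnS leq_divRL // => /andP[b0 bY] ->.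
by rewrite dvdn_mulr // muln_gt0 a0 b0 ltnS mulnC.
Qed.

Lemma sum_divisors (A : nmodType) (F : nat -> A) n Y : 0 < n <= Y ->
  (\sum_(d <- divisors n) F d = \sum_(1 <= d < Y.+1 | (d %| n)%N) F d)%R.
Proof.
case/andP=> n0 nY; rewrite -[RHS]big_filter; apply: perm_big; apply: uniq_perm.
- exact: divisors_uniq.
- by rewrite filter_uniq // iota_uniq.
move=> d; rewrite mem_filter mem_index_iota -dvdn_divisors //.
case dn: (d %| n) => //=; rewrite (dvdn_gt0 n0 dn) ltnS.
by rewrite (leq_trans (dvdn_leq n0 dn)).
Qed.

Lemma sum_sub_seq (A : numDomainType) (c : nat -> A) (s : seq nat) Y :
  uniq s -> {subset s <= index_iota 1 Y} ->
  (forall n, 0 < n < Y -> (0 <= c n)%R) ->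
  (\sum_(n <- s) c n <= \sum_(1 <= n < Y) c n)%R.
Proof.
move=> s_uniq sY c0; rewrite [leRHS](bigID (mem s)) /=.
rewrite -[X in (_ <= X + _)%R]big_filter.
have s_perm : perm_eq [seq i <- index_iota 1 Y | i \in s] s.
  apply: uniq_perm => //; first by rewrite filter_uniq // iota_uniq.
  move=> n; rewrite mem_filter; case ns: (n \in s) => //=.
  exact: sY.
rewrite (perm_big _ s_perm) lerDl big_seq_cond sumr_ge0 // => n.
by rewrite mem_index_iota => /andP[n_range _]; apply: c0.
Qed.

Section Hyperbola.

Variables (A : comPzRingType) (F G : nat -> A).

(** Every pair with [a * b <= X ^ 2] has [a <= X] or [b <= X]; the square where both hold is split
    off. *)
Lemma hyperbola X :
  (\sum_(1 <= a < (X ^ 2).+1) F a * (\sum_(1 <= b < (X ^ 2 %/ a).+1) G b) =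
   (\sum_(1 <= a < X.+1) F a) * (\sum_(1 <= b < X.+1) G b)
   + \sum_(1 <= a < X.+1) F a * (\sum_(X.+1 <= b < (X ^ 2 %/ a).+1) G b)
   + \sum_(1 <= b < X.+1) G b * (\sum_(X.+1 <= a < (X ^ 2 %/ b).+1) F a))%R.
Proof.
set Y := X ^ 2.
have XY : X <= Y by rewrite /Y; nia.
have Xdiv a : 0 < a <= X -> X <= Y %/ a.
  by case/andP=> a0 aX; rewrite leq_divRL // /Y expnS expn1 leq_mul2l aX orbT.
rewrite (big_cat_nat (n := X.+1)) //=.
congr (_ + _)%R.
  rewrite mulr_suml -big_split /= big_seq_cond [RHS]big_seq_cond.
  apply: eq_bigr => a; rewrite mem_index_iota ltnS andbT => aX.
  by rewrite -mulrDr -big_cat_nat //= ltnS Xdiv.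
transitivity (\sum_(X.+1 <= a < Y.+1) \sum_(1 <= b < X.+1 | (a * b <= Y)%N) F a * G b)%R.
  rewrite big_seq_cond [RHS]big_seq_cond.
  apply: eq_bigr => a; rewrite mem_index_iota andbT => /andP[Xa aY].
  have a0 : 0 < a by apply: leq_trans Xa.
  rewrite -mulr_sumr; congr (_ * _)%R.
  rewrite (big_nat_widen _ _ X.+1) /=; last first.
    rewrite ltnS -ltnS ltn_divLR // /Y expnS expn1; nia.
  by apply: eq_bigl => b; rewrite ltnS leq_divRL // mulnC.
rewrite (exchange_big_dep xpredT) //= big_seq_cond [RHS]big_seq_cond.
apply: eq_bigr => b; rewrite mem_index_iota andbT => /andP[b0 bX].
rewrite mulr_sumr [RHS](big_nat_widen _ _ Y.+1) /=; last by rewrite ltnS leq_div.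
apply: eq_big => [a|a _]; first by rewrite ltnS leq_divRL.
by rewrite mulrC.
Qed.

End Hyperbola.

(** * Sums weighted by 1/sqrt(n) *)

Section InverseSqrt.

Variable R : rcfType.

Definition isqrt (n : nat) : R := ((Num.sqrt n%:R)^-1)%R.

Lemma isqrt_ge0 n : (0 <= isqrt n)%R.
Proof. by rewrite invr_ge0 sqrtr_ge0. Qed.

Lemma isqrtM m n : isqrt (m * n) = (isqrt m * isqrt n)%R.
Proof. by rewrite /isqrt natrM sqrtrM ?ler0n // invfM. Qed.

Lemma isqrt1 : isqrt 1 = 1%R.
Proof. by rewrite /isqrt sqrtr1 invr1. Qed.

Lemma isqrt_sqr n : isqrt (n ^ 2) = (n%:R^-1)%R.
Proof. by rewrite /isqrt natrX sqrtr_sqr ger0_norm ?ler0n. Qed.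

Lemma isqrt_anti m n : 0 < m <= n -> (isqrt n <= isqrt m)%R.
Proof.
case/andP=> m0 mn; rewrite lef_pV2 ?posrE ?sqrtr_gt0 ?ltr0n //.
  by rewrite ler_sqrt ?ltr0n ?ler_nat // (leq_trans m0).
by rewrite (leq_trans m0).
Qed.

(** Telescoping, since 1/sqrt(n+1) is at most 2 (sqrt(n+1) - sqrt(n)). *)
Lemma sum_isqrt X : (\sum_(1 <= n < X.+1) isqrt n <= 2 * Num.sqrt X%:R)%R.
Proof.
elim: X => [|X IH]; first by rewrite big_geq // sqrtr0 mulr0.
rewrite big_nat_recr //= /isqrt.
have h := sqr_sqrtr (ler0n R X); have h1 := sqr_sqrtr (ler0n R X.+1).
have s0 := sqrtr_ge0 (X%:R : R).
have s1 : (0 < Num.sqrt (X.+1%:R : R))%R by rewrite sqrtr_gt0 ltr0n.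
have s01 : (Num.sqrt (X%:R : R) <= Num.sqrt X.+1%:R)%R by rewrite ler_sqrt ?ler_nat.
move: IH h h1 s0 s1 s01; rewrite -[X.+1]addn1 natrD.
move: (Num.sqrt X%:R) (Num.sqrt (X%:R + 1)) (\sum_(_ <= _ < _) _)%R => u v S.
move=> hS hu hv u0 v0 uv; apply: (le_trans (lerD hS (lexx _))).
rewrite -(ler_pM2r v0) mulrDl mulVf ?gt_eqF //.
nra.
Qed.

Lemma abel_bound (f : nat -> R) (C : R) A B : 0 < A ->
  (forall k, `|\sum_(A <= n < k) f n| <= C)%R ->
  (`|\sum_(A <= n < B) f n * isqrt n| <= C * isqrt A)%R.
Proof.
move=> A0 hC; have C0 : (0 <= C)%R by apply: le_trans (hC A).
case: (leqP B A) => [BA|AB].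
  by rewrite big_geq // normr0 mulr_ge0 ?isqrt_ge0.
(* Subtracting the boundary term of the summation by parts leaves a bound that is additive in [B],
   fit for induction. *)
suff h : (`|\sum_(A <= n < B) f n * isqrt n - (\sum_(A <= n < B) f n) * isqrt B|
          <= C * (isqrt A - isqrt B))%R.
  rewrite -[X in `|X|%R](subrK ((\sum_(A <= n < B) f n) * isqrt B)%R).
  apply: (le_trans (ler_normD _ _)).
  have : (`|(\sum_(A <= n < B) f n) * isqrt B| <= C * isqrt B)%R.
    by rewrite normrM (ger0_norm (isqrt_ge0 B)) ler_wpM2r ?isqrt_ge0.
  by move: h; lra.
elim: B {AB} (ltnW AB) => [|B IH]; first by lia.
rewrite leq_eqVlt => /orP[/eqP<-|]; first by rewrite !big_geq // mul0r !subrr mulr0 normr0.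
rewrite ltnS => AB; have {}IH := IH AB.
have -> : (\sum_(A <= n < B.+1) f n * isqrt n
           - (\sum_(A <= n < B.+1) f n) * isqrt B.+1 =
           (\sum_(A <= n < B) f n * isqrt n - (\sum_(A <= n < B) f n) * isqrt B)
           + (\sum_(A <= n < B.+1) f n) * (isqrt B - isqrt B.+1))%R.
  by rewrite !big_nat_recr //=; ring.
apply: (le_trans (ler_normD _ _)).
have w : (0 <= isqrt B - isqrt B.+1)%R.
  by rewrite subr_ge0 isqrt_anti // (leq_trans A0 AB) leqnSn.
have : (`|(\sum_(A <= n < B.+1) f n) * (isqrt B - isqrt B.+1)|
        <= C * (isqrt B - isqrt B.+1))%R.
  by rewrite normrM (ger0_norm w) ler_wpM2r.
by move: IH; lra.
Qed.

(** The constant is 1 + 2 + 2: the square contributes [C ^+ 2], and in each tail the weights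
    [isqrt a * isqrt X.+1] sum to at most 2. *)
Lemma hyperbola_bound (f g : nat -> R) (C : R) X :
  (forall A k, `|\sum_(A <= n < k) f n| <= C)%R ->
  (forall A k, `|\sum_(A <= n < k) g n| <= C)%R ->
  (`|\sum_(1 <= a < (X ^ 2).+1) f a * isqrt a *
       (\sum_(1 <= b < (X ^ 2 %/ a).+1) g b * isqrt b)| <= 5 * C ^+ 2)%R.
Proof.
move=> hf hg; have C0 : (0 <= C)%R by apply: le_trans (hf 0 0).
rewrite (hyperbola (fun a => f a * isqrt a)%R (fun b => g b * isqrt b)%R).
have box h : (forall A k, `|\sum_(A <= n < k) h n| <= C)%R ->
    (`|\sum_(1 <= a < X.+1) h a * isqrt a| <= C)%R.
  by move=> hh; have := abel_bound X.+1 (ltnSn 0) (hh 1); rewrite isqrt1 mulr1.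
have tail h v : (forall A k, `|\sum_(A <= n < k) h n| <= C)%R ->
    (forall A k, `|\sum_(A <= n < k) v n| <= C)%R ->
    (`|\sum_(1 <= a < X.+1) h a * isqrt a *
        (\sum_(X.+1 <= b < (X ^ 2 %/ a).+1) v b * isqrt b)| <= 2 * C ^+ 2)%R.
  move=> hh hv; apply: (le_trans (ler_norm_sum _ _ _)).
  have X0 : (0 < Num.sqrt (X.+1%:R : R))%R by rewrite sqrtr_gt0 ltr0n.
  apply: (@le_trans _ _ (\sum_(1 <= a < X.+1) isqrt a * (C * (C * isqrt X.+1))))%R.
    apply: ler_sum => a _; rewrite !normrM (ger0_norm (isqrt_ge0 a)).
    rewrite -mulrA mulrCA ler_wpM2l ?isqrt_ge0 // ler_pM ?normr_ge0 //.
      by have := hh a a.+1; rewrite big_nat1.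
    exact: abel_bound.
  rewrite -mulr_suml.
  have -> : (2 * C ^+ 2 = 2 * (C * C))%R by ring.
  rewrite [(C * (C * _))%R]mulrA mulrCA [leRHS]mulrC ler_wpM2l ?mulr_ge0 //.
  rewrite ler_pdivrMr //; apply: (le_trans (sum_isqrt X)).
  by rewrite ler_wpM2l // ler_sqrt ?ler_nat.
have := tail _ _ hf hg; have := tail _ _ hg hf.
have := ler_pM (normr_ge0 _) (normr_ge0 _) (box _ hf) (box _ hg).
rewrite -normrM.
move=> h1 h2 h3; apply: (le_trans (ler_normD _ _)).
apply: (le_trans (lerD (ler_normD _ _) (lexx _))).
apply: (le_trans (lerD (lerD h1 h3) h2)); rewrite le_eqVlt; apply/orP; left.
by apply/eqP; ring.
Qed.

Lemma harmonic_bound t : (t%:R / 2 <= \sum_(j < 2 ^ t) (j.+1%:R : R)^-1)%R.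
Proof.
elim: t => [|t IH]; first by rewrite mul0r sumr_ge0 // => i _; rewrite invr_ge0 ler0n.
rewrite -(big_mkord xpredT (fun j => (j.+1%:R : R)^-1)%R).
rewrite (big_cat_nat (n := 2 ^ t)) //=; last by rewrite leq_exp2l.
rewrite big_mkord -addn1 natrD mulrDl lerD //.
have -> : (1 / 2 = \sum_(2 ^ t <= j < 2 ^ t.+1) ((2 ^ t.+1)%:R : R)^-1)%R.
  have e : 2 ^ t.+1 - 2 ^ t = 2 ^ t by rewrite expnS mul2n -addnn addnK.
  rewrite sumr_const_nat e -mulr_natr expnS natrM.
  have : ((2 ^ t)%:R != 0 :> R)%R by rewrite pnatr_eq0 expn_eq0.
  by move=> h; field.
rewrite addn1; apply: ler_sum_nat => j => /andP[_ jt].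
by rewrite lef_pV2 ?posrE ?ltr0n ?expn_gt0 // ler_nat.
Qed.

End InverseSqrt.

(** * Primes split by one character and not by another *)

Lemma real_char_le1 M f n : real_char M f -> (`|f n| <= 1)%R.
Proof.
move=> fchar; have [_ _ fC] := fchar; have := fC n; case: ifP => [nM _|_ ->] //.
by case: (real_char_cases fchar nM) => ->.
Qed.

Lemma real_char_mod M f n k : real_char M f -> f (n + k * M) = f n.
Proof.
case=> fP _ _; elim: k => [|k IH]; first by rewrite addn0.
by rewrite mulSn [M + _]addnC addnA fP.
Qed.

Lemma real_char_modn M f n : real_char M f -> f (n %% M) = f n.
Proof. by move=> fchar; rewrite [in RHS](divn_eq n M) addnC real_char_mod. Qed.

Lemma real_charM M f g : real_char M f -> real_char M g ->
  real_char M (fun n => f n * g n)%R.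
Proof.
case=> fP fM fC [gP gM gC]; split=> [n|m n|n]; first by rewrite fP gP.
  by rewrite fM gM mulrACA.
have := fC n; have := gC n; case: ifP => _; last by move=> -> ->.
by rewrite mulrACA => -> ->.
Qed.

(** Multiplication by [r] permutes the residues and changes the sign of the sum. *)
Lemma real_char_sum0 M f r A : 0 < M -> real_char M f -> coprime r M ->
  f r = (-1)%R -> (\sum_(A <= n < A + M) f n = 0)%R.
Proof.
move=> M0 fchar rM fr; have [fP fM _] := fchar.
have -> : (\sum_(A <= n < A + M) f n = \sum_(0 <= n < M) f n)%R.
  elim: A => [|A IH]; first by rewrite add0n.
  rewrite -IH addSn big_nat_recr /=; last by lia.
  by rewrite [RHS]big_ltn ?fP 1?addrC //; lia.
rewrite big_mkord.
have lt (x : 'I_M) : r * x %% M < M by rewrite ltn_pmod.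
have inj : injective (fun x => Ordinal (lt x)).
  move=> x y /(congr1 val) /= /eqP.
  wlog xy : x y / x <= y.
    case: (leqP x y) => xy; first by apply.
    by move=> H; rewrite eq_sym => h; apply/esym/H => //; apply: ltnW.
  rewrite eq_sym eqn_mod_dvd ?leq_mul2l ?xy ?orbT // -mulnBr Gauss_dvdr 1?coprime_sym //.
  case: (posnP (y - x)) => h; first by move=> _; apply/val_inj => /=; lia.
  by rewrite gtnNdvd //; have := ltn_ord y; lia.
have : (\sum_(x < M) f x = - \sum_(x < M) f x)%R.
  rewrite [LHS](reindex_inj inj) /= -sumrN; apply: eq_bigr => x _.
  by rewrite (real_char_modn _ fchar) fM fr mulN1r.
by move: (\sum_(_ < _) _)%R => u; lia.
Qed.

Lemma real_char_sum_le M f r A B : 0 < M -> real_char M f -> coprime r M ->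
  f r = (-1)%R -> (`|\sum_(A <= n < B) f n| <= M%:Z)%R.
Proof.
move=> M0 fchar rM fr; elim/ltn_ind: B => B IH.
case: (leqP (A + M) B) => hB.
  rewrite (big_cat_nat (n := B - M)) /=; try lia.
  have -> : (\sum_(B - M <= n < B) f n = 0)%R.
    rewrite -[X in index_iota _ X](subnK (_ : M <= B)); last by lia.
    exact: real_char_sum0 fr.
  by rewrite addr0 IH //; lia.
apply: (le_trans (ler_norm_sum _ _ _)).
apply: (@le_trans _ _ (\sum_(A <= n < B) 1)%R).
  by apply: ler_sum => n _; apply: real_char_le1 fchar.
by rewrite sumr_const_nat; lia.
Qed.

(* Otherwise [div_sum chi] would equal [psi * div_sum chi], the convolution of
   [psi] and [psi * chi]; with X = 2 ^ t * M, its weighted sum up to X ^ 2 is at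
   most 5 M ^ 2 and at least t / (2 M). *)
Lemma exists_split_prime M r (chi psi : nat -> int) : 0 < M -> coprime r M ->
  real_char M chi -> real_char M psi -> chi r = 1%R -> psi r = (-1)%R ->
  exists q, [/\ prime q, q <= (2 ^ (10 * M ^ 3 + 1) * M) ^ 2,
                coprime q M, chi q = 1%R & psi q = (-1)%R].
Proof.
move=> M0 rM chi_char psi_char chi_r psi_r.
(* [t] is chosen so that [t / (2 * M)] exceeds [5 * M ^ 2]. *)
set t := 10 * M ^ 3 + 1; set X := 2 ^ t * M; set Y := X ^ 2.
have [/existsP[q /and4P[q_pr qM /eqP chi_q /eqP psi_q]]|noq] := boolP
  [exists q : 'I_Y.+1, [&& prime q, coprime q M, chi q == 1%R & psi q == (-1)%R]].
  by exists q; split=> //; rewrite -ltnS.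
exfalso; have hq q : prime q -> q <= Y -> coprime q M -> chi q = 1%R -> psi q = 1%R.
  move=> q_pr qY qM chi_q; case: (real_char_cases psi_char qM) => // psi_q.
  move/existsPn: noq; have qY' : q < Y.+1 by rewrite ltnS.
  by move=> /(_ (Ordinal qY')); rewrite /= q_pr qM chi_q psi_q !eqxx.
pose R := realalg.
have bound h A k : real_char M h -> h r = (-1)%R ->
    (`|\sum_(A <= n < k) (h n)%:~R| <= M%:R :> R)%R.
  move=> h_char hr; rewrite -rmorph_sum /= -intr_norm.
  by rewrite -[M%:R%R]/((M%:Z)%:~R)%R ler_int (real_char_sum_le _ _ M0 h_char rM).
have psichi_r : (psi r * chi r = -1)%R by rewrite chi_r psi_r mulr1.
have := hyperbola_bound X (fun A k => bound _ A k (real_charM psi_char chi_char) psichi_r)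
  (fun A k => bound _ A k psi_char psi_r).
pose F n : R := ((psi n * div_sum chi n)%:~R * isqrt R n)%R.
have F_char n : 0 < n <= Y -> coprime n M -> F n = ((div_sum chi n)%:~R * isqrt R n)%R.
  case/andP=> n0 nY nM; rewrite /F; case: (real_char_cases psi_char nM) => hn.
    by rewrite hn mul1r.
  rewrite (div_sum_eq0 chi_char psi_char n0 nM _ hn) ?mulr0 ?mul0r // => q q_pr qn.
  by apply: hq => //; apply: leq_trans nY.
(* Group the pairs by [n = a * b], using [psi n * chi a = (psi a * chi a) * psi b]. *)
have -> : (\sum_(1 <= a < Y.+1) (psi a * chi a)%:~R * isqrt R a *
     (\sum_(1 <= b < (Y %/ a).+1) (psi b)%:~R * isqrt R b) =
     \sum_(1 <= n < Y.+1) F n)%R.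
  transitivity (\sum_(1 <= n < Y.+1) \sum_(1 <= d < Y.+1 | (d %| n)%N)
       (psi n * chi d)%:~R * isqrt R n)%R; last first.
    rewrite big_seq_cond [RHS]big_seq_cond; apply: eq_bigr => n.
    rewrite mem_index_iota ltnS andbT => n_range.
    by rewrite -sum_divisors // -mulr_suml /F /div_sum -rmorph_sum mulr_sumr.
  rewrite (exchange_big_dep xpredT) //=.
  rewrite big_seq_cond [RHS]big_seq_cond; apply: eq_bigr => a.
  rewrite mem_index_iota andbT => /andP[a0 _].
  rewrite sum_multiples_reindex // mulr_sumr; apply: eq_bigr => b _.
  have [_ psiM _] := psi_char; rewrite psiM isqrtM !rmorphM /=; ring.
have F_ge0 n : 0 < n < Y.+1 -> (0 <= F n)%R.
  rewrite ltnS => n_range; case nM : (coprime n M).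
    rewrite F_char // mulr_ge0 ?isqrt_ge0 // ler0z (div_sum_ge0 chi_char) //.
    by case/andP: n_range.
  have [_ _ psiC] := psi_char; have := psiC n.
  by rewrite nM /F => ->; rewrite mul0r mul0r.
rewrite -/Y ger0_norm; last first.
  by rewrite big_seq_cond sumr_ge0 // => n; rewrite mem_index_iota andbT => /F_ge0.
(* Squares of integers congruent to 1 modulo [M]: they are coprime to [M] with divisor sum at least
   1, and their weights form a harmonic series. *)
pose s := [seq (j * M + 1) ^ 2 | j <- iota 0 (2 ^ t)].
have s_uniq : uniq s.
  rewrite map_inj_uniq ?iota_uniq // => i j /eqP.
  by rewrite eqn_exp2r // eqn_add2r eqn_pmul2r // => /eqP.
have sY : {subset s <= index_iota 1 Y.+1}.
  move=> n /mapP[j]; rewrite mem_iota add0n => /andP[_ jt] ->.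
  rewrite mem_index_iota expn_gt0 addn1 /= ltnS leq_exp2r // /X.
  by nia.
apply/negP; rewrite -ltNge; apply: (lt_le_trans _ (sum_sub_seq s_uniq sY F_ge0)).
have M0' : (0 < M%:R :> R)%R by rewrite ltr0n.
apply: (@lt_le_trans _ _ ((M%:R)^-1 * (t%:R / 2)))%R.
  rewrite [ltRHS]mulrC ltr_pdivlMr // ltr_pdivlMr //.
  rewrite -!natrX -!natrM ltr_nat /t; nia.
apply: (le_trans (ler_wpM2l _ (harmonic_bound R t))).
  by rewrite invr_ge0 ler0n.
rewrite /s big_map -[X in iota _ X]subn0 -/(index_iota _ _) big_mkord mulr_sumr.
apply: ler_sum => j _.
have k0 : 0 < (j * M + 1) ^ 2 <= Y.
  have : (j * M + 1) ^ 2 \in s by apply: map_f; rewrite mem_iota add0n ltn_ord.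
  by move/sY; rewrite mem_index_iota ltnS.
have kM : coprime ((j * M + 1) ^ 2) M.
  by rewrite coprimeXl // /coprime gcdnC gcdnMDl gcdn1.
rewrite F_char // isqrt_sqr -invfM -natrM.
apply: (@le_trans _ _ (1 * ((j * M + 1)%:R)^-1))%R.
  rewrite mul1r lef_pV2 ?posrE ?ltr0n ?addn1 ?muln_gt0 ?M0 // ler_nat; nia.
rewrite ler_wpM2r ?invr_ge0 ?ler0n //.
by rewrite -[1%R]/(1%:~R)%R ler_int (div_sum_sqr chi_char) // addn1.
Qed.

(** [K] is maximal among subgroups containing [H] and avoiding [r]. Adjoining [x] outside [K]
    captures [r] as [k * x ^+ i], with [i] odd because squares lie in [K]. *)
Lemma index2_separation (gT : finGroupType) (H : {group gT}) (r : gT) :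
  (forall x y : gT, commute x y) -> (forall x : gT, x * x \in H)%g -> r \notin H ->
  exists K : {group gT},
    [/\ H \subset K, r \notin K & forall x, x \notin K -> (x * r \in K)%g].
Proof.
move=> comm sqH rH.
pose avoids := [pred K : {group gT} | (H \subset K) && (r \notin K)].
have H_avoids : avoids H by rewrite /= subxx.
have [K /maxgroupP[/andP[HK rK] Kmax] _] := maxgroup_exists H_avoids.
exists K; split=> // x xK; have sqK y : (y * y \in K)%g by rewrite (subsetP HK).
have rKx : r \in (K <*> <[x]>)%g.
  apply: contraR xK => rKx; rewrite -(Kmax (K <*> <[x]>)%G) ?joing_subl //=.
    by rewrite mem_gen // inE cycle_id orbT.
  by rewrite rKx (subset_trans HK) ?joing_subl.
have cKx : (<[x]> \subset 'C(K))%g.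
  by apply/subsetP => y _; apply/centP => z _; apply: comm.
move: rKx; rewrite /= cent_joinEr // => /mulsgP[k y kK /cycleP[i ->] er].
have xiE : (x ^+ i \in K)%g = ~~ odd i.
  have evenK j : (x ^+ j.*2 \in K)%g by rewrite -addnn expgD sqK.
  rewrite -(odd_double_half i); case: (odd i) => /=; last by rewrite add0n evenK odd_double.
  by rewrite add1n expgS groupMr ?evenK //= odd_double (negbTE xK).
have i_odd : odd i.
  by apply: contraR rK; rewrite -xiE er => /(groupM kK).
rewrite er comm -mulgA groupM // -expgSr.
rewrite -[i.+1](odd_double_half) /= i_odd add0n -addnn expgD; exact: sqK.
Qed.

Section UnitResidue.

Variable M : nat.
Hypothesis M1 : 1 < M.

(** Integers not coprime to [M] are sent to 1. *)
Definition unit_residue (n : nat) : {unit 'Z_M} := insubd (1%g : {unit 'Z_M}) (n%:R)%R.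

Lemma val_unit_residue n : coprime n M -> val (unit_residue n) = (n%:R)%R.
Proof. by move=> nM; rewrite val_insubd unitZpE // coprime_sym nM. Qed.

Lemma unit_residueM m n : coprime m M -> coprime n M ->
  unit_residue (m * n) = (unit_residue m * unit_residue n)%g.
Proof.
move=> mM nM; apply: val_inj.
by rewrite val_unit_residue ?coprimeMl ?mM //= !val_unit_residue // natrM.
Qed.

Lemma eq_unit_residue m n : coprime m M -> coprime n M ->
  (unit_residue m == unit_residue n) = (m == n %[mod M]).
Proof.
move=> mM nM; rewrite -val_eqE !val_unit_residue //.
by rewrite -(Zp_nat_mod M1 m) -(Zp_nat_mod M1 n) -val_eqE /= !val_Zp_nat // !modn_mod.
Qed.

Lemma unit_residue_surj (x : {unit 'Z_M}) : exists2 n, coprime n M & x = unit_residue n.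
Proof.
have nM : coprime (val x : 'Z_M) M.
  by rewrite coprime_sym -unitZpE // natr_Zp; exact: valP x.
by exists (val x : 'Z_M) => //; apply: val_inj; rewrite val_unit_residue // natr_Zp.
Qed.

End UnitResidue.

(* The m * y ^ 2 form a subgroup of the residues containing all squares; if it
   missed r, a quadratic character trivial on it would contradict
   [exists_split_prime]. *)
Lemma split_product_mod_squares M r (chi : nat -> int) : 1 < M -> coprime r M ->
  real_char M chi -> chi r = 1%R ->
  exists m y, [/\ 0 < m, coprime m M, coprime y M,
    forall q, prime q -> q %| m -> chi q = 1%R & m * y ^ 2 = r %[mod M]].
Proof.
move=> M1 rM chi_char chi_r; have M0 := ltnW M1.
(* The bound of [exists_split_prime], so that finitely many primes suffice as generators. *)
pose B := (2 ^ (10 * M ^ 3 + 1) * M) ^ 2.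
pose u := unit_residue M.
pose split q := [&& prime q, coprime q M & chi q == 1%R].
pose gens : {set {unit 'Z_M}} :=
  [set (x * x)%g | x in [set: {unit 'Z_M}]] :|: [set u (val q) | q : 'I_B.+1 & split (val q)].
have sq_gens x : (x * x)%g \in <<gens>>%g.
  by rewrite mem_gen // inE; apply/orP; left; apply/imsetP; exists x; rewrite ?inE.
have [r_in|r_out] := boolP (u r \in <<gens>>%g).
  have [n [c c_gens er]] := gen_prodgP r_in.
  suff [m [y [m0 mM yM hm e]]] : exists m y, [/\ 0 < m, coprime m M, coprime y M,
      forall q, prime q -> q %| m -> chi q = 1%R & u (m * y ^ 2) = u r].
    have myM : coprime (m * y ^ 2) M by rewrite coprimeMl mM coprimeXl.
    exists m, y; split=> //; apply/eqP; rewrite -(eq_unit_residue M1) //.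
    by apply/eqP.
  rewrite er; apply: (big_ind (fun x => exists m y, [/\ 0 < m, coprime m M, coprime y M,
      forall q, prime q -> q %| m -> chi q = 1%R & u (m * y ^ 2) = x])).
  - exists 1, 1; rewrite !coprime1n; split=> //.
      by move=> q q_pr; rewrite dvdn1 => /eqP q1; rewrite q1 in q_pr.
    by apply: val_inj; rewrite val_unit_residue // coprime1n.
  - move=> x x' [m [y [m0 mM yM hm <-]]] [m' [y' [m0' mM' yM' hm' <-]]].
    exists (m * m'), (y * y'); rewrite !coprimeMl mM mM' yM yM' muln_gt0 m0 m0'; split=> //.
      by move=> q q_pr; rewrite Euclid_dvdM // => /orP[/hm|/hm']; apply.
    by rewrite -unit_residueM ?(coprimeMl, mM, mM', coprimeXl, yM, yM') // expnMn mulnACA.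
  move=> i _; have := c_gens i; rewrite inE => /orP[/imsetP[x _ ->]|/imsetP[q]].
    have [y yM ->] := unit_residue_surj M1 x.
    exists 1, y; rewrite coprime1n; split=> //.
      by move=> q q_pr; rewrite dvdn1 => /eqP q1; rewrite q1 in q_pr.
    by rewrite mul1n -mulnn [u _]unit_residueM.
  rewrite inE => /and3P[q_pr qM /eqP chi_q ->].
  exists (val q), 1; rewrite coprime1n prime_gt0 //; split=> //.
    by move=> p p_pr; rewrite dvdn_prime2 // => /eqP->.
  by rewrite exp1n muln1.
exfalso.
have comm (x y : {unit 'Z_M}) : commute x y by apply: unit_Zp_mulgC.
have [K [HK rK hK]] := index2_separation comm sq_gens r_out.
(* The quadratic character with kernel [K], extended by 0. *)
pose psi n : int := if coprime n M then (if u n \in K then 1 else -1)%R else 0%R.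
have sqK x : (x * x)%g \in K by apply: (subsetP HK); apply: sq_gens.
have psi_char : real_char M psi.
  split=> [n|m n|n].
  - have nM : coprime (n + M) M = coprime n M.
      by rewrite coprime_sym /coprime gcdnDr gcdnC.
    rewrite /psi nM; case: ifP => // nM'.
    suff -> : u (n + M) = u n by [].
    by apply/eqP; rewrite eq_unit_residue ?nM // modnDr.
  - rewrite /psi coprimeMl; case: (boolP (coprime m M)) => mM /=; last by rewrite mul0r.
    case: (boolP (coprime n M)) => nM /=; last by rewrite mulr0.
    rewrite [u (m * n)]unit_residueM // -/(u m) -/(u n).
    case: (boolP (u m \in K)) => hm; first by rewrite groupMl // mul1r.
    case: (boolP (u n \in K)) => hn; first by rewrite groupMr // (negbTE hm) mulr1.
    have := groupM (hK _ hm) (hK _ hn).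
    have -> : (u m * u r * (u n * u r) = u m * u n * (u r * u r))%g.
      by rewrite !mulgA -(mulgA (u m) (u r)) (comm (u r) (u n)) !mulgA.
    rewrite groupMr ?sqK //.
    by move=> ->; rewrite mulrNN mulr1.
  - by rewrite /psi; case: (coprime n M) => //; case: (_ \in K).
have psi_r : psi r = (-1)%R by rewrite /psi rM (negbTE rK).
have [q [q_pr qB qM chi_q]] := exists_split_prime M0 rM chi_char psi_char chi_r psi_r.
rewrite /psi qM; case: ifP => // /negP[]; apply: (subsetP HK); apply: mem_gen.
rewrite inE; apply/orP; right; rewrite -ltnS in qB.
by apply/imsetP; exists (Ordinal qB); rewrite ?inE //= /split q_pr qM chi_q eqxx.
Qed.

(** * Sums of three squares *)

Lemma chi_neg_real_char N : 0 < N -> real_char (4 * N) (chi_neg N).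
Proof.
move=> N0; split=> [n|m n|n]; [exact: chi_neg_period | exact: chi_negM |].
by case: ifP => [/chi_neg_sqr|h] //; rewrite /chi_neg h.
Qed.

(** A prime already dividing [m0] moves into the square part; a new one is adjoined by the Chinese
    remainder theorem, so roots need no lifting to prime powers. *)
Lemma neg_square_modulo (N : int) (m : nat) : 0 < m ->
  (forall q, prime q -> q %| m -> exists B : int, (q%:Z %| (N + B ^+ 2)%R)%Z) ->
  exists m0 k (B : int), m = m0 * k ^ 2 /\ (m0%:Z %| (N + B ^+ 2)%R)%Z.
Proof.
elim/ltn_ind: m => m IH m_gt0 hm; case: (leqP m 1) => m1.
  by exists 1, 1, 0%R; split; [lia | rewrite dvd1z].
have q_pr := pdiv_prime m1; have qm := pdiv_dvd m; move: (pdiv m) q_pr qm => q q_pr qm.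
have q1 := prime_gt1 q_pr; case/dvdnP: qm => m' em.
have [m'_lt m'_gt0] : m' < m /\ 0 < m' by nia.
have [|m0 [k [B [em' hB]]]] := IH m' m'_lt m'_gt0.
  by move=> p p_pr pm; apply: hm => //; rewrite em dvdn_mulr.
have [qm0|qm0] := boolP (q %| m0).
  case/dvdnP: qm0 => m2 em2; exists m2, (q * k), B; split; first by rewrite em em' em2; ring.
  by apply: dvdz_trans hB; rewrite em2 PoszM dvdz_mulr.
have [|Bq hBq] := hm q q_pr; first by rewrite em dvdn_mull.
have cop : coprimez q m0 by rewrite /coprimez /gcdz /= -[_ == _]/(coprime q m0) prime_coprime.
exists (q * m0), k, (zchinese q m0 Bq B); split; first by rewrite em em'; ring.
have congr_sqr (p z B1 : int) : (z = B1 %[mod p])%Z ->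
    (p %| (N + B1 ^+ 2)%R)%Z -> (p %| (N + z ^+ 2)%R)%Z.
  move=> /eqP; rewrite eqz_mod_dvd => pz hp.
  have -> : (N + z ^+ 2 = N + B1 ^+ 2 + (z - B1) * (z + B1))%R by ring.
  by rewrite rpredD ?dvdz_mulr.
rewrite PoszM Gauss_dvdz //; apply/andP; split.
  by apply: congr_sqr hBq; apply: zchinese_modl.
by apply: congr_sqr hB; apply: zchinese_modr.
Qed.

Lemma dvd2_addn_sqr (n : nat) (z : int) : odd n -> ~~ (2 %| z)%Z ->
  (2%:Z %| (n%:Z + z ^+ 2)%R)%Z.
Proof.
move=> n_odd z_odd; have [j ->] : exists j, (z = 2 * j + 1)%R by exists (z %/ 2)%Z; lia.
have [i ->] : exists i, n = 2 * i + 1 by exists n./2; lia.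
by apply/dvdzP; exists (i%:Z + 1 + 2 * j ^+ 2 + 2 * j)%R; rewrite PoszD PoszM; ring.
Qed.

Lemma dvd2_addn_odd (n : nat) (z : int) : odd n -> (2 %| z)%Z -> ~~ (2 %| (z + n%:Z)%R)%Z.
Proof. lia. Qed.

(* c * m is opposite to the square of m * y modulo N. *)
Lemma sum3sq_of_split N m y c : 0 < N -> 0 < m -> odd m -> coprime m N ->
  (forall q, prime q -> q %| m -> chi_neg N q = 1%R) ->
  (c == 1) || (c == 2) && odd N ->
  N %| m * y ^ 2 + c -> sum_of_three_squares N%:Z%R.
Proof.
move=> N0 m_gt0 m_odd mN hm cN hy.
have [|m0 [k [B [em hB]]]] := @neg_square_modulo N%:Z%R m m_gt0.
  by move=> q q_pr qm; apply: chi_neg_prime => //; apply: hm.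
have m0_gt0 : 0 < m0 by move: m_gt0; rewrite em muln_gt0 => /andP[].
have m0N : coprime m0 N by move: mN; rewrite em coprimeMl => /andP[].
have m0_odd : odd m0 by move: m_odd; rewrite em oddM => /andP[].
have hu : (N%:Z %| ((c * m0)%N%:Z + (m0 * (k * y))%N%:Z ^+ 2)%R)%Z.
  have -> : ((c * m0)%N%:Z + (m0 * (k * y))%N%:Z ^+ 2 = (m0 * (m * y ^ 2 + c))%N%:Z)%R.
    by rewrite em !(PoszD, PoszM); ring.
  by rewrite PoszM dvdz_mull.
suff [B' hB'] : exists B' : int, ((c * m0)%N%:Z %| (N%:Z + B' ^+ 2)%R)%Z.
  apply: (sum3sq_of_residues N0 _ _ hu hB').
    by rewrite muln_gt0 m0_gt0; case: (c) cN.
  rewrite coprimeMl m0N andbT; case/orP: cN => [/eqP->|/andP[/eqP-> N_odd]].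
    by rewrite coprime1n.
  by rewrite coprime2n.
case/orP: cN => [/eqP->|/andP[/eqP-> N_odd]]; first by exists B; rewrite mul1n.
have cop2 : coprimez 2 m0.
  by rewrite /coprimez /gcdz /= -[_ == _]/(coprime 2 m0) coprime2n.
(* Adding the odd [m0] to an even [B] makes the root odd, so that 2 divides the sum of the odd [N]
   and its square. *)
exists (if (2 %| B)%Z then B + m0%:Z else B)%R; rewrite PoszM Gauss_dvdz //.
case: ifP => B2; apply/andP; split=> //; first by rewrite dvd2_addn_sqr // dvd2_addn_odd.
  have -> : (N%:Z + (B + m0%:Z) ^+ 2 = N%:Z + B ^+ 2 + m0%:Z * (2 * B + m0%:Z))%R by ring.
  by rewrite rpredD // dvdz_mulr.
by rewrite dvd2_addn_sqr // B2.
Qed.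

Theorem three_squares N : (N %% 4 \in [:: 1; 2]) || (N %% 8 == 3) ->
  sum_of_three_squares N%:Z%R.
Proof.
move=> hN; have N0 : 0 < N by case: N hN.
have M1 : 1 < 4 * N by lia.
(* Explicit residues opposite to [c] modulo [N] at which the symbol is 1; [c = 2] serves [N = 3]
   modulo 8. *)
have [r [c [chi_r c_cond hr]]] : exists r c,
    [/\ chi_neg N r = 1%R, (c == 1) || (c == 2) && odd N & N %| r + c].
  case/orP: hN => [|/eqP N8]; last first.
    exists (N - 2), 2; rewrite chi_neg_Nm2 // subnK ?dvdnn; last by lia.
    by split=> //; lia.
  rewrite !inE => /orP[/eqP N4|/eqP N4].
    exists (2 * N - 1), 1; rewrite chi_neg_2Nm1 // subnK ?dvdn_mull //; lia.
  by exists (N - 1), 1; rewrite chi_neg_Nm1 // subnK ?dvdnn.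
have rM : coprime r (4 * N).
  by apply: contraPT chi_r => /negbTE rM; rewrite /chi_neg rM.
have [m [y [m0 mM yM hm e]]] := split_product_mod_squares M1 rM (chi_neg_real_char N0) chi_r.
have mN : coprime m N by move: mM; rewrite coprimeMr => /andP[].
apply: (sum3sq_of_split (m := m) (y := y) (c := c)) => //; first exact: coprime4_odd mM.
have {}e : m * y ^ 2 = r %[mod N].
  by rewrite -(modn_dvdm _ (dvdn_mull 4 (dvdnn N))) e modn_dvdm // dvdn_mull.
by rewrite /dvdn -modnDml e modnDml.
Qed.

(** * The obstruction modulo 8 and the equivalences *)

Lemma sqr_mod8 (x : int) : exists y : int,
  (x ^+ 2 = 8 * y + 1 \/ (x ^+ 2 = 8 * y + 4 \/ x ^+ 2 = 8 * y) /\ (2 %| x)%Z)%R.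
Proof.
have ex : (x = (x %/ 4)%Z * 4 + (x %% 4)%Z)%R := divz_eq x 4.
have x4 : (0 <= (x %% 4)%Z < 4)%R by rewrite modz_ge0 ?ltz_pmod.
move: (x %/ 4)%Z (x %% 4)%Z ex x4 => q r -> r4.
have [->|[->|[->| ->]]] : (r = 0 \/ r = 1 \/ r = 2 \/ r = 3)%R by lia.
- exists (2 * q ^+ 2)%R; right; split; [right; ring | lia].
- exists (2 * q ^+ 2 + q)%R; left; ring.
- exists (2 * q ^+ 2 + 2 * q)%R; right; split; [left; ring | lia].
- exists (2 * q ^+ 2 + 3 * q + 1)%R; left; ring.
Qed.

Lemma not_sum3sq_7mod8 (N : int) : (N %% 8 = 7)%Z -> ~ sum_of_three_squares N.
Proof.
move=> N8 [x [y [z e]]].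
have [x' hx] := sqr_mod8 x; have [y' hy] := sqr_mod8 y; have [z' hz] := sqr_mod8 z.
by move: hx hy hz e; move: (x ^+ 2)%R (y ^+ 2)%R (z ^+ 2)%R => u v w; lia.
Qed.

Lemma sum3sq_4mul (N : int) :
  sum_of_three_squares (4 * N)%R <-> sum_of_three_squares N.
Proof.
split=> [[x [y [z e]]]|[x [y [z ->]]]]; last first.
  by exists (2 * x)%R, (2 * y)%R, (2 * z)%R; ring.
have even u v w : (4 * N = u ^+ 2 + v ^+ 2 + w ^+ 2)%R -> exists u', (u = 2 * u')%R.
  have [u' hu] := sqr_mod8 u; have [v' hv] := sqr_mod8 v; have [w' hw] := sqr_mod8 w.
  move=> {}e; exists (u %/ 2)%Z; suff : (2 %| u)%Z by lia.
  by move: hu hv hw e; move: (u ^+ 2)%R (v ^+ 2)%R (w ^+ 2)%R => u2 v2 w2; lia.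
have [x' ex] := even _ _ _ e.
have [y' ey] : exists y', (y = 2 * y')%R by apply: (even y x z); rewrite e; ring.
have [z' ez] : exists z', (z = 2 * z')%R by apply: (even z x y); rewrite e; ring.
exists x', y', z'; have h4 : (4 != 0 :> int)%R by [].
by apply: (mulfI h4); rewrite e ex ey ez; ring.
Qed.

Lemma not_sum3sq_beven n : ~ sum_of_three_squares (beven n)%:Z%R <-> chi n = 1.
Proof.
case: (posnP n) => [->|n0].
  rewrite beven0; split=> // h; exfalso; apply: h.
  by exists 1%R, 0%R, 0%R.
have := beven_chi n0; case: eqP => chi_n h; split=> // ns.
- have -> : ((beven n)%:Z = 4 * (beven n %/ 4)%:Z)%R by lia.
  by rewrite sum3sq_4mul; apply: not_sum3sq_7mod8; lia.
- exfalso; apply: ns; case: h => [h|].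
    by apply: three_squares; rewrite !inE; lia.
  rewrite !inE => h; have -> : ((beven n)%:Z = 4 * (beven n %/ 4)%:Z)%R by lia.
  by rewrite sum3sq_4mul; apply: three_squares; rewrite !inE; lia.
Qed.

Lemma chi_4X k n : chi (2 ^ (2 * k) * n) = chi n.
Proof.
have [_ _ chi_4n _ _] := chi_satisfies.
elim: k => [|k IH]; first by rewrite mul1n.
by rewrite mulnS expnD -mulnA chi_4n.
Qed.

Lemma chi_eq1 n : chi n = 1 ->
  exists k s, n = 2 ^ (2 * k + 1) * (4 * s + 1) /\ t s = (-1)%R.
Proof.
have [chi_0 chi_odd chi_4n chi_8n2 chi_8n6] := chi_satisfies.
elim/ltn_ind: n => n IH; case: (posnP n) => [->|n0]; first by rewrite chi_0.
have [r hr] : exists r, [\/ n = 2 * r + 1, n = 4 * r, n = 8 * r + 2 | n = 8 * r + 6].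
  exists (if odd n then n./2 else if 4 %| n then n %/ 4 else n %/ 8).
  case: ifP => n_odd; first by constructor 1; lia.
  case: ifP => n4; first by constructor 2; lia.
  by case: (n %% 8 =P 2) => n8; [constructor 3 | constructor 4]; lia.
case: hr => e; rewrite e ?chi_odd ?chi_8n6 // => chi_n.
  rewrite chi_4n in chi_n; have rn : r < n by lia.
  have [k [s [er ts]]] := IH r rn chi_n.
  by exists k.+1, s; split=> //; rewrite er mulnS -addnA (expnD 2 2) -mulnA.
exists 0, r; split; first by rewrite muln0 -[2 ^ _]/2; lia.
by apply/eqP; rewrite -T_t; rewrite chi_8n2 in chi_n; apply/eqP.
Qed.

Theorem corollary3p3 (n : nat) :
  [<-> ~ sum_of_three_squares (b (2 * n))%:Z%R;
       exists k s : nat, n = 2 ^ (2 * k + 1) * (4 * s + 1) /\ t s = (-1)%R;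
       exists k r : nat,
         (n%:Z = 2 ^+ (2 * k + 1)%N * (8 * r%:Z + 2 * t r + 3))%R;
       chi n = 1].
Proof.
have pow2 e : (2 ^+ e = (2 ^ e)%N%:Z :> int)%R by rewrite -[RHS]natz natrX.
tfae.
- by move/not_sum3sq_beven/chi_eq1.
(* With [r = s./2], [4 * s + 1] is [8 * r + 1] or [8 * r + 5], and [t s = -1] gives [t r = -1] or
   [t r = 1] respectively. *)
- case=> k [s [-> ts]]; exists k, s./2; rewrite PoszM pow2; congr (_ * _)%R.
  move: ts; rewrite -[in t s](odd_double_half s).
  by case: (boolP (odd s)) => hs; rewrite ?add0n ?add1n ?t_odd ?t_even; lia.
(* [2 * (8 * r + 2 * t r + 3)] equals [8 * s + 2], where [s] is whichever of [r.*2] and [r.*2.+1]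
   has [t s = -1]. *)
- case=> k [r]; rewrite addn1 exprSr -mulrA.
  have [_ _ _ chi_8n2 _] := chi_satisfies.
  case: (t_cases r) => hr; rewrite hr pow2 => h.
    have -> : n = 2 ^ (2 * k) * (8 * r.*2.+1 + 2) by move: (2 ^ _) h => q; lia.
    by rewrite chi_4X chi_8n2; apply/eqP; rewrite T_t t_odd hr.
  have -> : n = 2 ^ (2 * k) * (8 * r.*2 + 2) by move: (2 ^ _) h => q; lia.
  by rewrite chi_4X chi_8n2; apply/eqP; rewrite T_t t_even hr.
- by move=> h; apply/not_sum3sq_beven.
Qed.
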